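(* Given two integers $K$ and $c$ with $K\ge 4$ and $2\le c\le K-2$, ML-VDISJ-PATH with $p=2$ source-sink pairs is polynomially reducible to ML-CAP-STEINER-TREE with $K$ terminals and uniform capacity $c$ (that is, $c(e)=c$ for every $e\in E$). (This holds for undirected graphs, and likewise for directed graphs.)
   Context: Graphs $G=(V,E)$ are finite and may be directed or undirected; ''path'' means directed path in the directed case. ML-CAP-STEINER-TREE. Input: a connected graph $G=(V,E)$; a set $T\subset V$ of $K\ge 2$ terminals; a root $r\in V\setminus T$ (if $G$ is directed, there is a directed path from $r$ to every vertex of $V$); a nonnegative rational length $\ell(e)$ and a positive integer capacity $c(e)$ for every $e\in E$. Objective: determine, if one exists, a tree $S$ in $G$, directed away from its root $r$, that spans all vertices of $T$ (it need not span $V$), satisfies the capacity constraints, and has minimum total length. The capacity constraints say: for every arc $e=(u,v)$ of $S$, the subtree of $S$ rooted at $v$ contains at most $c(e)$ terminals. If $G$ is undirected, an arc $(u,v)$ of $S$ must be such that $[u,v]\in E$, and it has the length and capacity of that edge. ML-VDISJ-PATH. Input: a graph $G=(V,E)$; a nonnegative length function $\ell$ on $E$; $p$ disjoint vertex pairs (source-sink pairs) $(s_1,s'_1),\dots,(s_p,s'_p)$. Objective: find, if they exist, $p$ mutually vertex-disjoint paths $\mu_1,\dots,\mu_p$ of minimum total length such that $\mu_i$ links $s_i$ to $s'_i$ for $i=1,\dots,p$. ''Polynomially reducible'' here means: there is a polynomial-time transformation of instances $I$ of the first problem into instances $I'$ of the second (of the indicated form) such that $I$ is feasible if and only if $I'$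 is, and any optimal solution of $I'$ can be converted in polynomial time into an optimal solution of $I$. The integers $K$ and $c$ are constants, not part of the input. *)

(* Defs.v *)
From mathcomp Require Import all_boot all_order all_algebra.
From mathcomp Require Import zify.

Set Implicit Arguments.
Unset Strict Implicit.
Unset Printing Implicit Defensive.

Import Order.TTheory GRing.Theory Num.Theory.

(** * Polynomial time

    A While language over binary trees, in combinator form.  A primitive step
    is charged the size of the tree it reads, so the running time bounds the
    sizes of the input, of the output and of all intermediate values: repeated
    pairing cannot build an exponentially large tree in polynomial time, and
    polynomial time here agrees with that of Turing machines. *)

Inductive tree := Leaf | Node of tree & tree.

Fixpoint tsize (x : tree) : nat :=
  if x is Node y z then (tsize y + tsize z).+1 else 1.

Inductive prog :=
  | Pid
  | Pleaf
  | Pfst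
  | Psnd
  | Peq                               (* are the two components equal? *)
  | Ppair of prog & prog
  | Pseq of prog & prog               (* first argument runs first *)
  | Pif of prog & prog & prog
  | Pwhile of prog & prog.            (* test, body *)

(* [eval p x y t]: on input [x], [p] halts with output [y] in time [t].
   As a truth value, [Leaf] is false and every [Node] is true. *)
Inductive eval : prog -> tree -> tree -> nat -> Prop :=
  | EvId x : eval Pid x x (tsize x)
  | EvLeaf x : eval Pleaf x Leaf (tsize x)
  | EvFstLeaf : eval Pfst Leaf Leaf (tsize Leaf)
  | EvFst x y : eval Pfst (Node x y) x (tsize (Node x y))
  | EvSndLeaf : eval Psnd Leaf Leaf (tsize Leaf)
  | EvSnd x y : eval Psnd (Node x y) y (tsize (Node x y))
  | EvEqLeaf : eval Peq Leaf Leaf (tsize Leaf)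
  | EvEqTrue x : eval Peq (Node x x) (Node Leaf Leaf) (tsize (Node x x))
  | EvEqFalse x y : x <> y -> eval Peq (Node x y) Leaf (tsize (Node x y))
  | EvPair p q x y z t u : eval p x y t -> eval q x z u ->
      eval (Ppair p q) x (Node y z) (t + u).+1
  | EvSeq p q x y z t u : eval p x y t -> eval q y z u ->
      eval (Pseq p q) x z (t + u).+1
  | EvIfTrue b p q x y1 y2 z t u : eval b x (Node y1 y2) t -> eval p x z u ->
      eval (Pif b p q) x z (t + u).+1
  | EvIfFalse b p q x z t u : eval b x Leaf t -> eval q x z u ->
      eval (Pif b p q) x z (t + u).+1
  | EvWhileStop b p x t : eval b x Leaf t -> eval (Pwhile b p) x x t.+1
  | EvWhileStep b p x y1 y2 y z t u v :
      eval b x (Node y1 y2) t -> eval p x y u -> eval (Pwhile b p) y z v ->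
      eval (Pwhile b p) x z (t + u + v).+1.

Lemma tsize_gt0 x : 0 < tsize x.
Proof. by case: x. Qed.

Lemma eval_size p x y t : eval p x y t -> tsize x <= t /\ tsize y <= t.
Proof.
elim=> //=; do ?[by move=> *; split; lia].
all: by move=> z; have := tsize_gt0 z; lia.
Qed.

Lemma eval_functional p x y z t u :
  eval p x y t -> eval p x z u -> y = z /\ t = u.
Proof.
move=> e; move: z u; elim: e => {p x y t}; intros;
  match goal with h : eval _ _ ?z _ |- _ = ?z /\ _ => inversion h; subst end => //;
  do 3?[match goal with
    ih : forall z u, eval ?p ?x z u -> _, h : eval ?p ?x _ _ |- _ =>
      case: (ih _ _ h) => {ih} // ? ?; subst => //
    end].
Qed.

Definition runs_within (p : prog) (x y : tree) (bound : nat) : Prop :=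
  exists2 t, eval p x y t & t <= bound.

(** * Minimization problems and polynomial reductions *)

(* An instance or a solution may have several codes, which differ in the order
   in which the elements of finite sets are listed. *)
Record opt_problem := OptProblem {
  inst : Type;
  is_inst : inst -> Prop;
  sol : inst -> Type;
  feasible : forall I : inst, sol I -> Prop;
  value : forall I : inst, sol I -> rat;
  codes_inst : tree -> inst -> Prop;
  codes_sol : forall I : inst, tree -> sol I -> Prop
}.
Arguments is_inst {o} I.
Arguments sol {o} I.
Arguments feasible {o I} S : rename.
Arguments value {o I} S : rename.
Arguments codes_inst {o} d I : rename.
Arguments codes_sol {o I} d S : rename.

Definition solvable (P : opt_problem) (I : inst P) : Prop :=
  exists S : sol I, feasible S.

Definition optimal (P : opt_problem) (I : inst P) (S : sol I) : Prop :=
  feasible S /\ forall S' : sol I, feasible S' -> (value S <= value S')%R.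

Definition restrict (P : opt_problem) (C : inst P -> Prop) : opt_problem :=
  {| inst := inst P;
     is_inst := fun I => is_inst I /\ C I;
     sol := @sol P;
     feasible := @feasible P;
     value := @value P;
     codes_inst := @codes_inst P;
     codes_sol := @codes_sol P |}.

(* [F] computes the transformation [f]; [G] converts an optimal solution of
   [f I], given together with [I], into an optimal solution of [I]. *)
Definition poly_reducible (P Q : opt_problem) : Prop :=
  exists (f : inst P -> inst Q) (F G : prog) (a k : nat),
  forall I : inst P, is_inst I ->
  [/\ is_inst (f I),
      forall d, codes_inst d I ->
        exists2 d', codes_inst d' (f I) & runs_within F d d' (a * tsize d ^ k),
      solvable I <-> solvable (f I)
    & forall (d : tree) (S' : sol (f I)) (d' : tree),
        codes_inst d I -> optimal S' -> codes_sol d' S' ->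
        exists (S : sol I) (e : tree),
          [/\ optimal S, codes_sol e S
            & runs_within G (Node d d') e (a * tsize (Node d d') ^ k)]].

(** * Codes of basic data *)

Definition code_seq (s : seq tree) : tree := foldr Node Leaf s.

Fixpoint code_pos (n : BinNums.positive) : tree :=
  match n with
  | BinNums.xH => Leaf
  | BinNums.xO m => Node Leaf (code_pos m)
  | BinNums.xI m => Node (Node Leaf Leaf) (code_pos m)
  end.

Definition code_nat (n : nat) : tree :=
  if bin_of_nat n is BinNums.Npos m then Node Leaf (code_pos m) else Leaf.

Definition code_int (z : int) : tree :=
  match z with
  | Posz n => Node Leaf (code_nat n)
  | Negz n => Node (Node Leaf Leaf) (code_nat n.+1)
  end.

Definition code_rat (q : rat) : tree :=
  Node (code_int (numq q)) (code_int (denq q)).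

(* Numbers are written in binary, except vertex names and the number of
   vertices, which are written in unary: the size of a graph is at least its
   number of vertices. *)
Definition code_unary (n : nat) : tree := code_seq (nseq n Leaf).

Definition code_vertex (n : nat) (v : 'I_n) : tree := code_unary v.

Definition code_pair (n : nat) (a : 'I_n * 'I_n) : tree :=
  Node (code_vertex a.1) (code_vertex a.2).

Definition lists (T : eqType) (s : seq T) (A : pred T) : Prop :=
  uniq s /\ s =i A.

(** * Weighted graphs, paths and trees *)

(* An undirected graph is one in which every edge [u,v] is present as the two
   arcs (u,v) and (v,u), with equal lengths.  The values of [len] outside
   [arc] are irrelevant. *)
Record wgraph := WGraph {
  order : nat;
  arc : rel 'I_order;
  len : 'I_order -> 'I_order -> rat
}.

Notation vertex G := 'I_(order G).

Definition symmetric_on (V : Type) (W : Type) (e : rel V) (w : V -> V -> W) :=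
  forall u v, e u v -> w u v = w v u.

Definition is_wgraph (directed : bool) (G : wgraph) : Prop :=
  [/\ irreflexive (@arc G),
      forall u v : vertex G, arc u v -> (0 <= len u v)%R
    & ~~ directed -> symmetric (@arc G) /\ symmetric_on (@arc G) (@len G)].

Definition arcs (G : wgraph) : pred (vertex G * vertex G) :=
  fun a => arc a.1 a.2.

(* A path is the sequence of its vertices, both ends included. *)
Definition links (V : eqType) (e : rel V) (x y : V) (mu : seq V) : bool :=
  if mu is z :: q then [&& z == x, path e z q, last z q == y & uniq mu]
  else false.

Definition path_length (G : wgraph) (mu : seq (vertex G)) : rat :=
  (\sum_(a <- zip mu (behead mu)) len a.1 a.2)%R.

Section Arborescences.

Variable V : finType.
Implicit Types (r v : V) (S : {set V * V}).

Definition arc_rel S : rel V := fun u v => (u, v) \in S.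

Definition tree_vertices r S : {set V} :=
  r |: ([set a.1 | a in S] :|: [set a.2 | a in S]).

Definition arborescence r S : Prop :=
  forall v, v \in tree_vertices r S ->
    connect (arc_rel S) r v /\ #|[set u | (u, v) \in S]| = (v != r).

Definition subtree S v : {set V} := [set w | connect (arc_rel S) v w].

End Arborescences.

(** * ML-VDISJ-PATH *)

Record vdp_inst (p : nat) := VdpInst {
  vdp_graph :> wgraph;
  ends : p.-tuple (vertex vdp_graph * vertex vdp_graph)
}.

Definition ml_vdisj_path (directed : bool) (p : nat) : opt_problem :=
  {| inst := vdp_inst p;
     is_inst := fun I =>
       is_wgraph directed I /\ uniq (unzip1 (ends I) ++ unzip2 (ends I));
     sol := fun I => p.-tuple (seq (vertex I));
     feasible := fun I mu =>
       (forall i, links (@arc I) (tnth (ends I) i).1 (tnth (ends I) i).2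
                        (tnth mu i)) /\
       (forall i j, i != j -> [disjoint tnth mu i & tnth mu j]);
     value := fun I mu => (\sum_(i < p) path_length (tnth mu i))%R;
     codes_inst := fun d I => exists2 s, lists s (@arcs I) &
       d = code_seq [:: code_unary (order I);
                        code_seq [seq Node (code_pair a)
                                           (code_rat (len a.1 a.2)) | a <- s];
                        code_seq [seq code_pair a | a <- ends I]];
     codes_sol := fun I d mu =>
       d = code_seq [seq code_seq [seq code_vertex v | v <- m] | m <- mu] |}.

(** * ML-CAP-STEINER-TREE *)

Record cst_inst := CstInst {
  cst_graph :> wgraph;
  cap : vertex cst_graph -> vertex cst_graph -> nat;
  terminals : {set vertex cst_graph};
  root : vertex cst_graph
}.

Definition is_cst_inst (directed : bool) (I : cst_inst) : Prop :=
  [/\ is_wgraph directed I,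
      if directed then forall v : vertex I, connect (@arc I) (root I) v
      else forall u v : vertex I, connect (@arc I) u v,
      forall u v : vertex I, arc u v -> 0 < cap u v,
      ~~ directed -> symmetric_on (@arc I) (@cap I)
    & 2 <= #|terminals I| /\ root I \notin terminals I].

(* The solution is the set of arcs of the tree, oriented away from the root. *)
Definition ml_cap_steiner_tree (directed : bool) : opt_problem :=
  {| inst := cst_inst;
     is_inst := is_cst_inst directed;
     sol := fun I => {set vertex I * vertex I};
     feasible := fun I S =>
       [/\ {subset S <= @arcs I},
           arborescence (root I) S,
           terminals I \subset tree_vertices (root I) S
         & forall u v, (u, v) \in S ->
             #|terminals I :&: subtree S v| <= cap u v];
     value := fun I S => (\sum_(a in S) len a.1 a.2)%R;
     codes_inst := fun d I =>
       exists s t, [/\ lists s (@arcs I), lists t (mem (terminals I)) &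
       d = code_seq [:: code_unary (order I);
                        code_seq [seq Node (code_pair a)
                                        (Node (code_rat (len a.1 a.2))
                                              (code_nat (cap a.1 a.2))) | a <- s];
                        code_seq [seq code_vertex v | v <- t];
                        code_vertex (root I)]];
     codes_sol := fun I d S => exists2 s, lists s (mem S) &
       d = code_seq [seq code_pair a | a <- s] |}.

Definition uniform_instance (K c : nat) (I : cst_inst) : Prop :=
  #|terminals I| = K /\ forall u v : vertex I, arc u v -> cap u v = c.

(* Main.v *)
(** Let [(s1, t1)] and [(s2, t2)] be the pairs.  The root is joined to [s1] and
    [s2], and terminals hang from the graph: [c] pendants at [t1], one at [s2],
    one at [t2], and the remaining [K - c - 2] at the root.  All pendants are
    below [t1], so [c] is used up at every ancestor of [t1] but the root: the
    two terminals at [s2] and [t2] are in another branch, and the tree contains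
    disjoint paths from [s1] to [t1] and from [s2] to [t2].  New arcs have
    length [0] and go both ways, so the same instance serves directed and
    undirected graphs.

    The new instance must be connected.  The terminals at [s2] and [t2] are also
    joined to [t1], which capacity makes useless, and vertices that none of the
    four ends reaches lose their arcs and are hung from the root; the set of
    reached vertices is computed by [n] rounds over the arcs.  Conversely, the
    paths are read off a tree by following parents from [t1] and [t2]. *)

From HB Require Import structures.
From mathcomp Require Import all_boot all_order all_algebra.
From mathcomp Require Import zify.
Require Import Defs.

Set Implicit Arguments.
Unset Strict Implicit.
Unset Printing Implicit Defensive.

Import Order.TTheory GRing.Theory Num.Theory.

(** * Polynomial-time functions on trees *)

(** The terminal at [s2] breaks the symmetry between the two pairs: without it a tree could run from
    [s1] to [t2] and from [s2] to [t1]. With it [s2] cannot be an ancestor of [t1], so [t1] lies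
    below [s1]; the terminal at [t2] is then excluded below [s1], which forces [t2] below [s2]. The
    branch of [s2] holds two terminals, whence [2 <= c]; the [c + 2] terminals at [t1], [s2] and
    [t2] explain [c <= K - 2]. Unreached vertices lose their arcs because the root, which has to be
    joined to them, could otherwise enter the graph through them and bypass [s1] and [s2].

    For the programs, the obstacle is the loop: its accumulator stays polynomial if each step adds
    an amount bounded in terms of data that the loop only reads. Unary names help twice: the code of
    [n] is itself a list to loop over, and old vertices keep their names in the new instance. *)

Lemma leq_expl k m n : m <= n -> m ^ k <= n ^ k.
Proof. by case: k => // k; rewrite leq_exp2r. Qed.

(** Trees have positive size. At [n = 0] a positive exponent would force [b 0 = 0], and raising
    exponents, as sums and products do, would be unsound. *)
Definition poly_bounded (b : nat -> nat) : Prop :=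
  exists a k, forall n, 0 < n -> b n <= a * n ^ k.

Lemma poly_bounded_const m : poly_bounded (fun=> m).
Proof. by exists m, 0 => n _; rewrite muln1. Qed.

Lemma poly_bounded_id : poly_bounded (fun n => n).
Proof. by exists 1, 1 => n _; rewrite mul1n. Qed.

Lemma poly_bounded_add b1 b2 :
  poly_bounded b1 -> poly_bounded b2 -> poly_bounded (fun n => b1 n + b2 n).
Proof.
move=> [a1 [k1 h1]] [a2 [k2 h2]]; exists (a1 + a2), (k1 + k2) => n n0.
rewrite mulnDl leq_add //.
  by apply: leq_trans (h1 n n0) _; rewrite leq_mul2l leq_pexp2l ?leq_addr ?orbT.
by apply: leq_trans (h2 n n0) _; rewrite leq_mul2l leq_pexp2l ?leq_addl ?orbT.
Qed.

Lemma poly_bounded_mul b1 b2 :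
  poly_bounded b1 -> poly_bounded b2 -> poly_bounded (fun n => b1 n * b2 n).
Proof.
move=> [a1 [k1 h1]] [a2 [k2 h2]]; exists (a1 * a2), (k1 + k2) => n n0.
by rewrite expnD mulnACA leq_mul ?h1 ?h2.
Qed.

Lemma poly_bounded_exp b k : poly_bounded b -> poly_bounded (fun n => b n ^ k).
Proof.
move=> hb; elim: k => [|k ih]; first exact: (poly_bounded_const 1).
have [a [m h]] := poly_bounded_mul hb ih.
by exists a, m => n n0; rewrite expnS; apply: h.
Qed.

Lemma poly_bounded_succ b : poly_bounded b -> poly_bounded (fun n => (b n).+1).
Proof.
move=> hb; have [a [m h]] := poly_bounded_add hb (poly_bounded_const 1).
by exists a, m => n n0; have := h n n0; rewrite addn1.
Qed.

Create HintDb polyb.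
#[local] Hint Resolve poly_bounded_const poly_bounded_id poly_bounded_add
  poly_bounded_mul poly_bounded_exp poly_bounded_succ : polyb.

Lemma runs_within_le p x y t u :
  runs_within p x y t -> t <= u -> runs_within p x y u.
Proof. by move=> [v e vt] tu; exists v => //; apply: leq_trans tu. Qed.

Lemma runs_within_size p x y t : runs_within p x y t -> tsize y <= t.
Proof. by move=> [v /eval_size[_ h] vt]; apply: leq_trans vt. Qed.

Lemma runs_within_seq p q x y z t u :
  runs_within p x y t -> runs_within q y z u ->
  runs_within (Pseq p q) x z (t + u).+1.
Proof.
by move=> [v ev vt] [w ew wu]; exists (v + w).+1; [exact: EvSeq ew | lia].
Qed.

Lemma runs_within_pair p q x y z t u :
  runs_within p x y t -> runs_within q x z u ->
  runs_within (Ppair p q) x (Node y z) (t + u).+1.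
Proof.
by move=> [v ev vt] [w ew wu]; exists (v + w).+1; [exact: EvPair | lia].
Qed.

Definition tfst x := if x is Node y _ then y else Leaf.
Definition tsnd x := if x is Node _ y then y else Leaf.
Definition ttrue := Node Leaf Leaf.
Definition truth x := if x is Node _ _ then true else false.

Fixpoint tree_eqb (x y : tree) : bool :=
  match x, y with
  | Leaf, Leaf => true
  | Node a b, Node a' b' => tree_eqb a a' && tree_eqb b b'
  | _, _ => false
  end.

Lemma tree_eqP : Equality.axiom tree_eqb.
Proof.
elim=> [|a iha b ihb] [|a' b'] /=; try by constructor.
by apply: (iffP andP) => [[/iha-> /ihb->]|[/iha ? /ihb ?]].
Qed.
HB.instance Definition _ := hasDecEq.Build tree tree_eqP.

Definition tbool (b : bool) := if b then ttrue else Leaf.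

Lemma truth_tbool b : truth (tbool b) = b.
Proof. by case: b. Qed.

Lemma runs_within_fst x : runs_within Pfst x (tfst x) (tsize x).
Proof. by case: x => [|y z]; eexists; try (by constructor); rewrite leqnn. Qed.

Lemma runs_within_snd x : runs_within Psnd x (tsnd x) (tsize x).
Proof. by case: x => [|y z]; eexists; try (by constructor); rewrite leqnn. Qed.

Definition polyfun (f : tree -> tree) : Prop :=
  exists p b, poly_bounded b /\ forall x, runs_within p x (f x) (b (tsize x)).

Lemma polyfun_id : polyfun (fun x => x).
Proof.
exists Pid, (fun n => n); split; first by auto with polyb.
by move=> x; exists (tsize x) => //; constructor.
Qed.

Lemma polyfun_leaf : polyfun (fun=> Leaf).
Proof.
exists Pleaf, (fun n => n); split; first by auto with polyb.
by move=> x; exists (tsize x) => //; constructor.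
Qed.

(** The intermediate value is no larger than the time spent producing it. The bound [b'] need not be
    monotone, so its monomial is substituted instead. *)
Lemma polyfun_comp f g : polyfun g -> polyfun f -> polyfun (fun x => g (f x)).
Proof.
move=> [q [b' [[a [k hg]] rg]]] [p [b [hf rf]]].
exists (Pseq p q), (fun n => (b n + a * b n ^ k).+1); split.
  by auto with polyb.
move=> x; apply: runs_within_seq (rf x) _; apply: runs_within_le (rg _) _.
apply: leq_trans (hg _ (tsize_gt0 _)) _.
by rewrite leq_mul2l leq_expl ?orbT // (runs_within_size (rf x)).
Qed.

Lemma polyfun_node f g :
  polyfun f -> polyfun g -> polyfun (fun x => Node (f x) (g x)).
Proof.
move=> [p [b [hf rf]]] [q [b' [hg rg]]].
exists (Ppair p q), (fun n => (b n + b' n).+1); split; first by auto with polyb.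
by move=> x; apply: runs_within_pair.
Qed.

Lemma polyfun_fst f : polyfun f -> polyfun (fun x => tfst (f x)).
Proof.
apply: polyfun_comp; exists Pfst, (fun n => n); split; first by auto with polyb.
exact: runs_within_fst.
Qed.

Lemma polyfun_snd f : polyfun f -> polyfun (fun x => tsnd (f x)).
Proof.
apply: polyfun_comp; exists Psnd, (fun n => n); split; first by auto with polyb.
exact: runs_within_snd.
Qed.

Lemma polyfun_eq f g :
  polyfun f -> polyfun g -> polyfun (fun x => tbool (f x == g x)).
Proof.
move=> hf hg; pose h z := tbool (tfst z == tsnd z).
suff hh : polyfun h by exact: (polyfun_comp hh (polyfun_node hf hg)).
(* [Peq] answers false on [Leaf], whereas [h Leaf] is true; rebuilding the pair first turns [Leaf]
   into [Node Leaf Leaf]. *)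
exists (Pseq (Ppair Pfst Psnd) Peq), (fun n => (n + n).+1 + (n + n).+1 + 1).
split; first by auto with polyb.
move=> x; rewrite addn1; have r := runs_within_pair (runs_within_fst x) (runs_within_snd x).
apply: runs_within_seq (r) _; rewrite /h.
exists (tsize (Node (tfst x) (tsnd x))); last exact: runs_within_size r.
by case: eqP => [->|ne]; constructor.
Qed.

Lemma polyfun_if b f g : polyfun b -> polyfun f -> polyfun g ->
  polyfun (fun x => if truth (b x) then f x else g x).
Proof.
move=> [p [bp [hp rp]]] [q [bq [hq rq]]] [r [br [hr rr]]].
exists (Pif p q r), (fun n => (bp n + (bq n + br n)).+1).
split; first by auto with polyb.
move=> x; have [t et lt] := rp x.
have [u eu lu] := rq x; have [v ev lv] := rr x.
case E: (b x) et => [|y z] et /=.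
  by exists (t + v).+1; [exact: EvIfFalse ev | lia].
by exists (t + u).+1; [exact: EvIfTrue et eu | lia].
Qed.

Lemma polyfun_const y : polyfun (fun=> y).
Proof.
by elim: y => [|y ihy z ihz]; [exact: polyfun_leaf | exact: polyfun_node].
Qed.

(* The step sees the whole remaining list, whose head is the current element:
   on the unary code of [n] it thus runs through the codes of [n], ..., [1]. *)
Fixpoint tfold (step : tree -> tree -> tree) (l s : tree) : tree :=
  if l is Node _ l' then tfold step l' (step l s) else s.

(** The increment is measured in [e] and [l], never in the accumulator: a step that doubled [s]
    would make it exponential. *)
Definition bounded_growth (step : tree -> tree -> tree -> tree) : Prop :=
  exists a k, forall e l s,
    tsize (step e l s) <= tsize s + a * (tsize e + tsize l) ^ k.

Lemma tsize_tfold step L w l s :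
  (forall l s, tsize l <= L -> tsize (step l s) <= tsize s + w) ->
  tsize l <= L -> tsize (tfold step l s) <= tsize s + tsize l * w.
Proof.
move=> h; elim: l s => [|x _ l ih] s lL /=; first by rewrite leq_addr.
have lL' : tsize l <= L by move: lL => /=; lia.
apply: leq_trans (ih _ lL') _; have := h _ s lL.
rewrite mulSn mulnDl; lia.
Qed.

(** The state is [Node e (Node l s)]; the test returns [l] itself, which is true exactly when
    something remains. *)
Definition ploop (q : prog) : prog :=
  Pwhile (Pseq Psnd Pfst)
    (Ppair Pfst (Ppair (Pseq (Pseq Psnd Pfst) Psnd) q)).

(** The quantity [tsize s + tsize l * w] does not increase: a turn adds at most [w] to [s] and
    shortens [l]. Hence every state has size at most [M], and a turn costs at most [20 * M] for
    projections and pairings, generously counted, plus one run of [q]. *)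
Lemma runs_within_loop step q (ba : nat) (bk w E L Q : nat) e l s :
  (forall l s, runs_within q (Node e (Node l s)) (step l s)
                 (ba * tsize (Node e (Node l s)) ^ bk)) ->
  (forall l s, tsize l <= L -> tsize (step l s) <= tsize s + w) ->
  tsize e <= E -> tsize l <= L -> tsize s + tsize l * w <= Q ->
  runs_within (ploop q) (Node e (Node l s)) (Node e (Node Leaf (tfold step l s)))
    (tsize l * (20 * (E + L + Q + 2) + ba * (E + L + Q + 2) ^ bk)).
Proof.
move=> rq gw eE; set M := E + L + Q + 2.
elim: l s => [|x _ l ih] s lL sQ.
  have r : runs_within (Pseq Psnd Pfst) (Node e (Node Leaf s)) Leaf
     (tsize (Node e (Node Leaf s)) + tsize (Node Leaf s)).+1.
    by apply: runs_within_seq (runs_within_snd _) (runs_within_fst _).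
  case: r => t et lt; exists t.+1; first exact: EvWhileStop.
  by move: lt; rewrite /= /M; lia.
have lL' : tsize l <= L by move: lL => /=; lia.
have sQ' : tsize (step (Node x l) s) + tsize l * w <= Q.
  have := gw (Node x l) s lL; have := tsize_gt0 x; move: sQ => /=; nia.
have [t3 e3 l3] := ih _ lL' sQ'.
set z := Node e (Node (Node x l) s).
have zM : tsize z <= M by rewrite /M; move: sQ lL eE => /=; lia.
have r1 : runs_within (Pseq Psnd Pfst) z (Node x l)
    (tsize z + tsize (tsnd z)).+1.
  exact: runs_within_seq (runs_within_snd z) (runs_within_fst (tsnd z)).
have r2 := runs_within_seq r1 (runs_within_snd _).
have r3 := runs_within_pair (runs_within_fst z)
  (runs_within_pair r2 (rq (Node x l) s)).
case: r1 r3 => t1 e1 l1 [t2 e2 l2].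
exists (t1 + t2 + t3).+1; first exact: EvWhileStep e1 e2 e3.
have szM : ba * tsize z ^ bk <= ba * M ^ bk by rewrite leq_mul2l leq_expl ?orbT.
have : tsize z <= M by [].
move: l1 l2 l3; rewrite -/z => l1 l2 l3 zM'.
have h : (t1 + t2).+1 <= 20 * M + ba * M ^ bk.
  by move: l1 l2 szM zM'; rewrite /=; lia.
have := tsize_gt0 x; rewrite [tsize (Node x l)]/=; move: h l3.
set D := 20 * M + _; move: (tsize x) (tsize l) => a b; nia.
Qed.

Lemma polyfun_fold step e l s :
  polyfun (fun z => step (tfst z) (tfst (tsnd z)) (tsnd (tsnd z))) ->
  bounded_growth step -> polyfun e -> polyfun l -> polyfun s ->
  polyfun (fun x => tfold (step (e x)) (l x) (s x)).
Proof.
move=> [q [bq [[ba [bk hq]] rq]]] [a [k hg]].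
move=> [pe [be [he re]]] [pl [bl [hl rl]]] [ps [bs [hs rs]]].
(* [w] bounds the growth per turn, [M] the size of any state and [T] the time of the whole loop. *)
pose w n := a * (be n + bl n) ^ k.
pose M n := be n + bl n + (bs n + bl n * w n) + 2.
pose T n := bl n * (20 * M n + ba * M n ^ bk).
exists (Pseq (Ppair pe (Ppair pl ps)) (Pseq (ploop q) (Pseq Psnd Psnd))).
exists (fun n => ((be n + (bl n + bs n).+1).+1 +
                  (T n + (T n + T n).+1).+1).+1).
split; first by rewrite /T /M /w; auto 20 with polyb.
move=> x; set n := tsize x.
apply: runs_within_seq.
  exact: runs_within_pair (re x) (runs_within_pair (rl x) (rs x)).
have E := runs_within_size (re x); have L := runs_within_size (rl x).
have S := runs_within_size (rs x).
have r : runs_within (ploop q) (Node (e x) (Node (l x) (s x)))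
    (Node (e x) (Node Leaf (tfold (step (e x)) (l x) (s x)))) (T n).
  apply: (@runs_within_le _ _ _ (tsize (l x) * (20 * M n + ba * M n ^ bk))).
    apply: (@runs_within_loop _ _ ba bk (w n) (be n) (bl n)) => //.
    - move=> l' s'; apply: runs_within_le (rq _) _; apply: hq; exact: tsize_gt0.
    - move=> l' s' l'L; apply: leq_trans (hg _ _ _) _.
      by rewrite leq_add2l leq_mul2l leq_expl ?orbT // leq_add.
    - by rewrite leq_add // leq_mul2r L orbT.
  by rewrite leq_mul2r L orbT.
apply: runs_within_seq (r) _; have := runs_within_size r.
set z := Node _ _ => zT.
apply: runs_within_le (runs_within_seq (runs_within_snd z) (runs_within_snd _)) _.
by move: zT; rewrite /z /=; lia.
Qed.

(** * Arborescences *)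

Section ArborescenceTheory.

Variables (V : finType) (r : V) (S : {set V * V}).
Hypothesis arbS : arborescence r S.
Implicit Types u v w : V.

Local Notation con := (connect (arc_rel S)).

Lemma head_in_tree u v : (u, v) \in S -> v \in tree_vertices r S.
Proof.
by move=> uv; rewrite !inE; apply/or3P; apply: Or33; apply/imsetP; exists (u, v).
Qed.

Lemma tail_in_tree u v : (u, v) \in S -> u \in tree_vertices r S.
Proof.
by move=> uv; rewrite !inE; apply/or3P; apply: Or32; apply/imsetP; exists (u, v).
Qed.

Lemma arborescence_functional u u' v : (u, v) \in S -> (u', v) \in S -> u = u'.
Proof.
move=> uv u'v; have [_ card_in] := arbS (head_in_tree uv).
have /card_le1_eqP h : #|[set u | (u, v) \in S]| <= 1 by rewrite card_in; case: eqP.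
by apply: h; rewrite inE.
Qed.

Lemma arborescence_root u : (u, r) \notin S.
Proof.
apply/negP => ur; have [_] := arbS (head_in_tree ur).
rewrite eqxx => /eqP; rewrite cards_eq0 => /eqP/setP/(_ u).
by rewrite !inE ur.
Qed.

Lemma arborescence_parent v :
  v \in tree_vertices r S -> v != r -> exists u, (u, v) \in S.
Proof.
move=> vS vr; have [_] := arbS vS; rewrite vr => h.
have /card_gt0P[u] : 0 < #|[set u | (u, v) \in S]| by rewrite h.
by rewrite inE => uv; exists u.
Qed.

Lemma connect_last u w : con u w -> u != w -> exists2 z, con u z & (z, w) \in S.
Proof.
case/connectP=> p; case/lastP: p => [|p z]; first by move=> _ ->; rewrite eqxx.
rewrite last_rcons rcons_path => /andP[up zS] -> _; exists (last u p) => //.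
by apply/connectP; exists p.
Qed.

Lemma connect_parent u w z : con u w -> u != w -> (z, w) \in S -> con u z.
Proof.
move=> uw nuw zw; have [y uy yw] := connect_last uw nuw.
by rewrite (arborescence_functional zw yw).
Qed.

Lemma connect_head u w : con u w -> u != w -> exists2 z, (u, z) \in S & con z w.
Proof.
case/connectP=> [[|z p]] /=; first by move=> _ ->; rewrite eqxx.
by move=> /andP[uz zp] -> _; exists z => //; apply/connectP; exists p.
Qed.

Lemma connect_to_root u : con u r -> u = r.
Proof.
move=> ur; apply/eqP; apply/idPn => nur; have [z _ zr] := connect_last ur nur.
by move: (arborescence_root z); rewrite zr.
Qed.

Lemma connect_in_tree u v :
  con u v -> v \in tree_vertices r S -> u \in tree_vertices r S.
Proof.
move=> uv vS; have [->//|nuv] := eqVneq u v.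
by have [z uz _] := connect_head uv nuv; apply: tail_in_tree uz.
Qed.

(* Being on a cycle propagates to the parent, hence up to the root. *)
Lemma arborescence_acyclic z w : (z, w) \in S -> ~~ con w z.
Proof.
move=> zw; apply/negP => wz; have [/connectP[p rp ew] _] := arbS (head_in_tree zw).
elim/last_ind: p w z zw wz rp ew => [|p y ih] w z zw wz rp ew.
  by move: zw; rewrite ew; apply/negP; apply: arborescence_root.
move: rp ew; rewrite rcons_path last_rcons => /andP[rp yS] ew.
have ez : z = last r p by rewrite ew in zw; apply: arborescence_functional zw yS.
have [ewz|nwz] := eqVneq w z.
  by apply: (ih z z) => //; rewrite -{2}ewz.
have [x wx xz] := connect_last wz nwz.
apply: (ih z x) => //.
by apply: connect_trans wx; apply: connect1.
Qed.

End ArborescenceTheory.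

(** The point is to find a parent for a vertex known only as the tail of an arc: the path from [r]
    to the head of that arc ends, by uniqueness of parents, with this very arc, and so passes
    through the tail. *)
Lemma arborescence_intro (V : finType) (r : V) (S : {set V * V}) :
  (forall u u' v, (u, v) \in S -> (u', v) \in S -> u = u') ->
  (forall u, (u, r) \notin S) ->
  (forall u v, (u, v) \in S -> connect (arc_rel S) r v) ->
  arborescence r S.
Proof.
move=> fS rS cS v vS.
have [->|nvr] := eqVneq v r.
  split=> //; apply/eqP; rewrite cards_eq0; apply/eqP/setP=> u.
  by rewrite !inE (negbTE (rS u)).
have [u uv] : exists u, (u, v) \in S.
  move: vS; rewrite !inE (negbTE nvr) /= => /orP[] /imsetP[[x y] xyS /= e]; last first.
    by exists x; rewrite e.
  have [e'|nry] := eqVneq r y; first by move: (rS x); rewrite e' xyS.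
  have [z rz zy] := connect_last (cS _ _ xyS) nry.
  rewrite (fS _ _ _ zy xyS) -e in rz.
  have [|w _ wv] := connect_last rz; first by rewrite eq_sym.
  by exists w.
split; first exact: cS uv.
rewrite (_ : [set _ | _] = [set u]) ?cards1 //.
by apply/setP=> w; rewrite !inE; apply/idP/eqP => [wv|->//]; apply: fS uv.
Qed.

Lemma path_zip (V : eqType) (x : V) q :
  path (fun u v => (u, v) \in zip (x :: q) q) x q.
Proof.
apply/(pathP x) => i iq.
set z := (_, _); have -> : z = nth (x, x) (zip (x :: q) q) i.
  by rewrite nth_zip_cond size_zip /= (minn_idPr _) ?iq.
by apply: mem_nth; rewrite size_zip /= (minn_idPr _).
Qed.

Lemma links_zip (V : eqType) (e : rel V) x y mu a :
  links e x y mu -> a \in zip mu (behead mu) -> e a.1 a.2.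
Proof.
case: mu => // z q /and4P[_ zq _ _] /=; elim: q z zq => //= z' q ih z /andP[ezz' zq].
by rewrite inE => /orP[/eqP->//|/ih]; apply.
Qed.

Lemma mem_zip (V W : eqType) (s : seq V) (t : seq W) a :
  a \in zip s t -> a.1 \in s /\ a.2 \in t.
Proof.
elim: s t => [|x s ih] [|y t] //=; rewrite !inE.
by case/orP=> [/eqP->|/ih[-> ->]]; rewrite ?eqxx ?orbT.
Qed.

Lemma unzip2_zip_behead (V : Type) (mu : seq V) :
  unzip2 (zip mu (behead mu)) = behead mu.
Proof. by rewrite unzip2_zip // size_behead leq_pred. Qed.

Lemma ler_sum_set (T : finType) (F : T -> rat) (s : seq T) (A : {set T}) :
  uniq s -> {subset s <= A} -> (forall a, a \in A -> 0 <= F a)%R ->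
  (\sum_(a <- s) F a <= \sum_(a in A) F a)%R.
Proof.
move=> us sA F0; rewrite big_uniq //= big_mkcond [leRHS]big_mkcond /=.
apply: ler_sum => a _; case: ifP => [/sA->//|_].
by case: ifP => // /F0.
Qed.

(** * The new instance *)

Section Gadget.

Variables (G : wgraph) (s1 s2 t1 t2 : vertex G) (K c : nat).

Definition reached (x : vertex G) : bool :=
  has (fun z => connect (@arc G) z x) [:: s1; s2; t1; t2].

(* The new vertices are numbered [0], ..., [K]: number [0] is the root, [1] and
   [2] are the terminals hanging from [s2] and [t2], numbers [3] to [c + 2] are
   the terminals hanging from [t1], the others hang from the root.  The links
   from [1] and [2] to [t1] and from the root to unreached vertices only make
   the graph connected. *)
Definition attached (j : nat) (x : vertex G) : bool :=
  match j with
  | 0 => (x \in [:: s1; s2]) || ~~ reached x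
  | 1 => x \in [:: s2; t1]
  | 2 => x \in [:: t2; t1]
  | _ => (j <= c.+2) && (x == t1)
  end.

Definition spoke (j j' : nat) : bool := (j == 0) && (c.+2 < j').

Definition gadget_arc : rel 'I_(order G + K.+1) := fun u v =>
  match split u, split v with
  | inl x, inl y => arc x y && reached x
  | inr j, inl x | inl x, inr j => attached j x
  | inr j, inr j' => spoke j j' || spoke j' j
  end.

Definition gadget_len (u v : 'I_(order G + K.+1)) : rat :=
  if (split u, split v) is (inl x, inl y) then len x y else 0%R.

Definition gadget : cst_inst :=
  @CstInst (WGraph gadget_arc gadget_len) (fun _ _ => c)
    [set rshift (order G) (lift ord0 j) | j : 'I_K] (rshift (order G) ord0).

Definition old (x : vertex G) : vertex gadget := lshift K.+1 x.
Definition new (j : 'I_K.+1) : vertex gadget := rshift (order G) j.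

Lemma old_inj : injective old. Proof. exact: lshift_inj. Qed.
Lemma new_inj : injective new. Proof. exact: rshift_inj. Qed.
Lemma old_new x j : (old x == new j) = false. Proof. exact: eq_lrshift. Qed.
Lemma new_old j x : (new j == old x) = false. Proof. exact: eq_rlshift. Qed.

Variant vertex_spec : vertex gadget -> Type :=
  | OldVertex x : vertex_spec (old x)
  | NewVertex j : vertex_spec (new j).

Lemma vertexP v : vertex_spec v.
Proof. by case: (split_ordP v) => x ->; constructor. Qed.

Lemma split_old x : split (old x) = inl x. Proof. exact: (unsplitK (inl x)). Qed.
Lemma split_new j : split (new j) = inr j. Proof. exact: (unsplitK (inr j)). Qed.

Lemma arc_old_old x y : gadget_arc (old x) (old y) = arc x y && reached x.
Proof. by rewrite /gadget_arc !split_old. Qed.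

Lemma arc_old_new x j : gadget_arc (old x) (new j) = attached j x.
Proof. by rewrite /gadget_arc split_old split_new. Qed.

Lemma arc_new_old x j : gadget_arc (new j) (old x) = attached j x.
Proof. by rewrite /gadget_arc split_old split_new. Qed.

Lemma arc_new_new j j' :
  gadget_arc (new j) (new j') = spoke j j' || spoke j' j.
Proof. by rewrite /gadget_arc !split_new. Qed.

Definition gadget_arcE := (arc_old_old, arc_old_new, arc_new_old, arc_new_new).

Lemma len_old_old x y : gadget_len (old x) (old y) = len x y.
Proof. by rewrite /gadget_len !split_old. Qed.

Lemma len_new j u : gadget_len u (new j) = 0%R.
Proof. by rewrite /gadget_len split_new; case: split. Qed.

Lemma len_new' j u : gadget_len (new j) u = 0%R.
Proof. by rewrite /gadget_len split_new. Qed.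

Lemma new_terminal j : (new j \in terminals gadget) = (j != ord0).
Proof.
apply/imsetP/idP => [[i _ /new_inj->]|j0]; first by rewrite eq_sym neq_lift.
by case: (unliftP ord0 j) j0 => [i|] -> //; exists i.
Qed.

Lemma old_terminal x : (old x \in terminals gadget) = false.
Proof. by apply/imsetP => -[i _ /eqP]; rewrite old_new. Qed.

Lemma card_terminals : #|terminals gadget| = K.
Proof.
by rewrite card_imset ?card_ord //; move=> i j /new_inj; apply: lift_inj.
Qed.

Hypotheses (c2 : 2 <= c) (cK : c.+2 <= K).

Definition pendants : {set vertex gadget} :=
  [set new (inord (3 + i)) | i : 'I_c].

Lemma new_pendant j : (new j \in pendants) = (2 < j <= c.+2).
Proof.
have jK := ltn_ord j.
apply/imsetP/idP => [[i _ /new_inj->]|h].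
  by have := ltn_ord i => hi; rewrite inordK; lia.
have hj : j - 3 < c by lia.
exists (Ordinal hj) => //; congr new; apply: val_inj => /=.
by rewrite inordK; lia.
Qed.

Lemma card_pendants : #|pendants| = c.
Proof.
rewrite card_imset ?card_ord // => i j /new_inj/(congr1 val).
have := ltn_ord i; have := ltn_ord j => hj hi.
rewrite /= !inordK; try lia; move=> e; apply: val_inj => /=; lia.
Qed.

Lemma attached_t1 j : (0 < j <= c.+2) -> attached j t1.
Proof. by case: j => [|[|[|j]]] //= => [_|_|->]; rewrite ?inE eqxx ?orbT. Qed.

Definition new1 : 'I_K.+1 := inord 1.
Definition new2 : 'I_K.+1 := inord 2.
Lemma val_new1 : new1 = 1 :> nat. Proof. by rewrite inordK; lia. Qed.
Lemma val_new2 : new2 = 2 :> nat. Proof. by rewrite inordK; lia. Qed.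

(** * Disjoint paths inside a feasible tree *)

Section TreeToPaths.

Variable directed : bool.
Variable S : {set vertex gadget * vertex gadget}.
Hypothesis feasS : @feasible (ml_cap_steiner_tree directed) gadget S.

Local Notation r := (root gadget).
Local Notation con := (connect (arc_rel S)).

Let arbS : arborescence r S. Proof. by case: feasS. Qed.
Let subS u v : (u, v) \in S -> gadget_arc u v.
Proof. by case: feasS => /(_ (u, v)) h _ _ _ /h. Qed.

Let termS j : j != ord0 -> new j \in tree_vertices r S.
Proof. by rewrite -new_terminal; case: feasS => _ _ /subsetP h _ /h. Qed.

Let parentS j : j != ord0 -> exists u, (u, new j) \in S.
Proof.
by move=> j0; apply: arborescence_parent (termS j0) _; rewrite // (inj_eq new_inj).
Qed.

Lemma parent_pendant (j : 'I_K.+1) : 2 < j <= c.+2 -> (old t1, new j) \in S.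
Proof.
move=> hj; have [|u uS] := @parentS j; first by rewrite -val_eqE /=; lia.
case: (vertexP u) uS => [x|i] xS; have := subS xS; rewrite gadget_arcE.
  case: (nat_of_ord j) hj => [|[|[|k]]] //= hk; rewrite hk /= => /eqP ex.
  by rewrite -ex.
by rewrite /spoke; lia.
Qed.

Lemma t1_in_tree : old t1 \in tree_vertices r S.
Proof.
by apply: (tail_in_tree r (@parent_pendant (inord 3) _)); rewrite inordK; lia.
Qed.

(* Below an ancestor [w] of [t1] the capacity [c] is used up by the pendants. *)
Lemma below_t1 w (j : 'I_K.+1) : w != r -> con w (old t1) -> con w (new j) ->
  j != ord0 -> 2 < j <= c.+2.
Proof.
move=> wr wt1 wj j0.
have pS : pendants \subset terminals gadget :&: subtree S w.
  apply/subsetP=> p /imsetP[i _ ->]; have hi := ltn_ord i.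
  have h : 2 < (inord (3 + i) : 'I_K.+1) <= c.+2 by rewrite inordK; lia.
  rewrite !inE new_terminal -val_eqE /= -lt0n (leq_trans _ (proj1 (andP h))) //=.
  by apply: connect_trans wt1 _; apply: connect1; apply: parent_pendant.
have capw : #|terminals gadget :&: subtree S w| <= c.
  have [z zw] := arborescence_parent arbS (connect_in_tree wt1 t1_in_tree) wr.
  by case: feasS => _ _ _; apply; apply: zw.
have /eqP e : pendants == terminals gadget :&: subtree S w.
  by rewrite eqEcard pS card_pendants.
by rewrite -new_pendant e !inE new_terminal j0.
Qed.

(** The only other neighbour is [t1], and below [t1] there is room for the pendants alone. *)
Lemma parent_new1 : (old s2, new new1) \in S.
Proof.
have [|u uS] := @parentS new1; first by rewrite -val_eqE /= val_new1.
case: (vertexP u) uS => [x|i] xS; have := subS xS; rewrite gadget_arcE; last first.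
  by rewrite /spoke val_new1; lia.
rewrite val_new1 /= !inE => /orP[] /eqP ex; first by rewrite -ex.
have tn : con (old t1) (new new1) by rewrite -{1}ex; apply: connect1.
have := below_t1 (negbT (old_new t1 ord0)) (connect0 _ _) tn.
by rewrite -val_eqE /= val_new1 => /(_ isT).
Qed.

Lemma parent_new2 : (old t2, new new2) \in S.
Proof.
have [|u uS] := @parentS new2; first by rewrite -val_eqE /= val_new2.
case: (vertexP u) uS => [x|i] xS; have := subS xS; rewrite gadget_arcE; last first.
  by rewrite /spoke val_new2; lia.
rewrite val_new2 /= !inE => /orP[] /eqP ex; first by rewrite -ex.
have tn : con (old t1) (new new2) by rewrite -{1}ex; apply: connect1.
have := below_t1 (negbT (old_new t1 ord0)) (connect0 _ _) tn.
by rewrite -val_eqE /= val_new2 => /(_ isT).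
Qed.

Lemma t1_not_below_new1 w : w != r -> con w (old t1) -> ~~ con w (new new1).
Proof.
move=> wr wt1; apply/negP => h; have := below_t1 wr wt1 h.
by rewrite -val_eqE /= val_new1 => /(_ isT).
Qed.

Lemma t1_not_below_new2 w : w != r -> con w (old t1) -> ~~ con w (new new2).
Proof.
move=> wr wt1; apply/negP => h; have := below_t1 wr wt1 h.
by rewrite -val_eqE /= val_new2 => /(_ isT).
Qed.

Lemma attached_reached j x : 0 < j -> attached j x -> reached x.
Proof.
rewrite /reached /=; case: j => [|[|[|j]]] //= _.
- by rewrite !inE => /orP[] /eqP->; rewrite connect0 ?orbT.
- by rewrite !inE => /orP[] /eqP->; rewrite connect0 ?orbT.
- by case/andP=> _ /eqP->; rewrite connect0 ?orbT.
Qed.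

(** The tree enters the reached part through [s1] or [s2] only. Every other child of the root is an
    unreached vertex or a terminal hung from the root; all arcs leaving it lead back to the root, so
    it is a leaf of the tree. *)
Lemma root_child x : reached x -> con r (old x) ->
  con (old s1) (old x) \/ con (old s2) (old x).
Proof.
move=> Rx rx; have [|z rz zx] := connect_head rx; first by rewrite new_old.
case: (vertexP z) rz zx => [y|j] rz zx; have := subS rz; rewrite gadget_arcE.
  move=> /orP[|NRy].
    by rewrite !inE => /orP[] /eqP <-; [left | right].
  have nyx : old y != old x.
    by apply: contraNneq NRy => /old_inj->.
  have [u yu _] := connect_head zx nyx.
  case: (vertexP u) yu => [y'|j] yu; have := subS yu; rewrite gadget_arcE.
    by rewrite (negbTE NRy) andbF.
  have [j0|j0] := posnP j.
    have ej : new j = r by congr new; apply: val_inj.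
    by move: (arborescence_root arbS (old y)); rewrite -ej yu.
  by move/(attached_reached j0); rewrite (negbTE NRy).
rewrite /spoke /= ltn0 andbF orbF => hj.
have [|u yu _] := connect_head zx; first by rewrite new_old.
case: (vertexP u) yu => [y'|j'] yu; have := subS yu; rewrite gadget_arcE.
  by case: (nat_of_ord j) hj => [|[|[|k]]] //=; lia.
rewrite /spoke => hj'; have j'0 : j' = 0 :> nat by lia.
have ej : new j' = r by congr new; apply: val_inj.
by move: (arborescence_root arbS (new j)); rewrite -ej yu.
Qed.

Let in_tree_con x : old x \in tree_vertices r S -> con r (old x).
Proof. by move=> h; have [] := arbS h. Qed.

Lemma connect_s1_t1 : con (old s1) (old t1).
Proof.
have rt1 := in_tree_con t1_in_tree.
have [|//|st] := root_child _ rt1; first by rewrite /reached /= connect0 !orbT.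
have /negP[] := t1_not_below_new1 (negbT (old_new s2 ord0)) st.
by apply: connect1; apply: parent_new1.
Qed.

(** As [s1] is now known to be an ancestor of [t1], it cannot also be one of [t2], above the
    terminal [new2]. *)
Lemma connect_s2_t2 : con (old s2) (old t2).
Proof.
have rt2 : con r (old t2) by apply: in_tree_con; apply: tail_in_tree parent_new2.
have [|st|//] := root_child _ rt2; first by rewrite /reached /= connect0 !orbT.
have /negP[] := t1_not_below_new2 (negbT (old_new s1 ord0)) connect_s1_t1.
by apply: connect_trans st (connect1 _); apply: parent_new2.
Qed.

(** A new vertex on the way is a terminal lying below an ancestor of [t1], namely itself, hence a
    pendant; but the parent of a pendant is [t1], which closes a cycle. *)
Lemma no_new_s1_t1 j : con (old s1) (new j) -> ~~ con (new j) (old t1).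
Proof.
move=> sj; apply/negP => jt.
have [j0|j0] := eqVneq j ord0.
  by move: sj; rewrite j0 => /(connect_to_root arbS)/eqP; rewrite old_new.
have hj : 2 < j <= c.+2 by apply: (below_t1 _ jt); rewrite ?(inj_eq new_inj).
by move: (arborescence_acyclic arbS (parent_pendant hj)); rewrite jt.
Qed.

(** The capacity count concerns ancestors of [t1] only, so here the parent of the new vertex is
    inspected. The root and [t1] are not below [s2], which leaves [new1] and [new2]. The parent of
    [new2] is [t2], giving a cycle; from [new1] the tree can only go on to [s2], a cycle again, or
    to [t1], which exceeds the capacity. *)
Lemma no_new_s2_t2 j : con (old s2) (new j) -> ~~ con (new j) (old t2).
Proof.
move=> sj; apply/negP => jt.
have not_root : ~ con (old s2) r.
  by move=> /(connect_to_root arbS)/eqP; rewrite old_new.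
have not_t1 : ~ con (old s2) (old t1).
  move=> st; have /negP[] := t1_not_below_new1 (negbT (old_new s2 ord0)) st.
  by apply: connect1; apply: parent_new1.
have [j0|j0] := eqVneq j ord0; first by apply: not_root; rewrite j0 in sj.
have [u uj] := parentS j0.
have su : con (old s2) u.
  by refine (connect_parent arbS sj _ uj); rewrite old_new.
case: (vertexP u) uj su => [x|i] uj su; have := subS uj; rewrite gadget_arcE.
  case E: (nat_of_ord j) => [|[|[|k]]].
  - by move: j0; rewrite -val_eqE /= E.
  - have ej : j = new1 by apply: val_inj; rewrite /= val_new1.
    move=> _; rewrite ej in jt; have [|z jz zt] := connect_head jt.
      by rewrite new_old.
    case: (vertexP z) jz zt => [y|i] jz zt; have := subS jz; rewrite gadget_arcE.
      rewrite val_new1 /= !inE => /orP[] /eqP ey.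
        have /negP[] := arborescence_acyclic arbS parent_new1.
        by rewrite -ey; apply: connect1.
      have nr : new new1 != r by rewrite (inj_eq new_inj) -val_eqE /= val_new1.
      have nt : con (new new1) (old t1) by rewrite -ey; apply: connect1.
      by have /negP[] := t1_not_below_new1 nr nt; apply: connect0.
    by rewrite /spoke val_new1; lia.
  - have ej : j = new2 by apply: val_inj; rewrite /= val_new2.
    by move: (arborescence_acyclic arbS parent_new2); rewrite -ej jt.
  - by move=> /= /andP[_ /eqP ex]; apply: not_t1; rewrite -ex.
rewrite /spoke => h; have j1 : 0 < j by rewrite lt0n.
have i0 : i = ord0 by apply: val_inj => /=; lia.
by apply: not_root; rewrite i0 in su.
Qed.

Lemma old_path a b p :
  path (arc_rel S) (old a) p -> last (old a) p = old b ->
  (forall j, con (old a) (new j) -> ~~ con (new j) (old b)) ->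
  exists q, p = map old q.
Proof.
elim: p a => [|z p ih] a; first by exists [::].
move=> /= /andP[az zp] lz noj.
case: (vertexP z) az zp lz => [x|j] az zp lz.
  have [j xj|q ->] := ih _ zp lz; last by exists (x :: q).
  by apply: noj; apply: connect_trans xj; apply: connect1.
have /negP[] := noj j (connect1 az).
by apply/connectP; exists p.
Qed.

Definition tree_arc : rel (vertex G) := fun x y => (old x, old y) \in S.

Lemma tree_arc_sub x y : tree_arc x y -> arc x y.
Proof. by move/subS; rewrite gadget_arcE => /andP[]. Qed.

Lemma links_tree a b : con (old a) (old b) ->
  (forall j, con (old a) (new j) -> ~~ con (new j) (old b)) ->
  exists mu, links tree_arc a b mu.
Proof.
case/connectP=> p0 /shortenP[p ap up _ {p0}] lp noj.
have [q ep] := old_path ap (esym lp) noj; exists (a :: q).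
move: ap lp up; rewrite ep path_map last_map -map_cons map_inj_uniq; last exact: old_inj.
by move=> /= -> /old_inj -> ->; rewrite !eqxx.
Qed.

Lemma tree_arc_connect x y : connect tree_arc x y -> con (old x) (old y).
Proof.
case/connectP=> p xp ->; apply/connectP; exists (map old p); last by rewrite last_map.
by rewrite path_map.
Qed.

Lemma links_connect_last (e : rel (vertex G)) a b mu x :
  links e a b mu -> x \in mu -> connect e x b.
Proof.
case: mu => // z q /and4P[_ + /eqP<- _] => /[swap] /splitPl[p1 p2 lx].
rewrite cat_path lx last_cat lx => /andP[_ p2x].
by apply/connectP; exists p2.
Qed.

(** A common vertex is old, hence not the root, and would be an ancestor of [t1] with the terminal
    [new2] below it. *)
Lemma disjoint_tree_links mu1 mu2 :
  links tree_arc s1 t1 mu1 -> links tree_arc s2 t2 mu2 -> [disjoint mu1 & mu2].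
Proof.
move=> h1 h2; apply/pred0P=> x; apply/negP => /andP[/= x1 x2].
have xt1 := tree_arc_connect (links_connect_last h1 x1).
have xt2 := tree_arc_connect (links_connect_last h2 x2).
have /negP[] := t1_not_below_new2 (negbT (old_new x ord0)) xt1.
by apply: connect_trans xt2 (connect1 _); apply: parent_new2.
Qed.

Lemma tree_links_length mu1 mu2 :
  (forall x y : vertex G, arc x y -> 0 <= len x y)%R ->
  links tree_arc s1 t1 mu1 -> links tree_arc s2 t2 mu2 ->
  (path_length mu1 + path_length mu2 <=
   @value (ml_cap_steiner_tree directed) gadget S)%R.
Proof.
move=> len0 h1 h2; pose oo (a : vertex G * vertex G) := (old a.1, old a.2).
pose s := zip mu1 (behead mu1) ++ zip mu2 (behead mu2).
have -> : (path_length mu1 + path_length mu2 =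
           \sum_(a <- map oo s) gadget_len a.1 a.2)%R.
  rewrite big_map big_cat /=; congr (_ + _)%R; apply: eq_bigr => a _;
  by rewrite len_old_old.
apply: ler_sum_set => [|a /mapP[b bs ->]|[u v] /subS].
- rewrite map_inj_uniq => [|[x y] [x' y'] e]; last first.
    by have [/= /old_inj-> /old_inj->] := (congr1 fst e, congr1 snd e).
  (* Even the heads of the arcs are distinct, since the two paths are simple and disjoint. *)
  apply: (@map_uniq _ _ snd); rewrite map_cat -!/(unzip2 _) !unzip2_zip_behead.
  have := disjoint_tree_links h1 h2.
  case: mu1 mu2 h1 h2 {s} => // z1 q1 [//|z2 q2].
  rewrite /= => /and4P[_ _ _ /andP[_ u1]] /and4P[_ _ _ /andP[_ u2]] d.
  rewrite cat_uniq u1 u2 andbT; apply/hasPn => x x2; apply/negP => x1.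
  by move/pred0P/(_ x): d; rewrite /= !inE x1 x2 !orbT.
- by move: bs; rewrite mem_cat => /orP[/(links_zip h1)|/(links_zip h2)].
- case: (vertexP u) => x; last by rewrite /= len_new'.
  case: (vertexP v) => y; last by rewrite /= len_new.
  by rewrite gadget_arcE /= len_old_old => /andP[/len0].
Qed.

End TreeToPaths.

(** * The tree built from two disjoint paths *)

Section PathsToTree.

Variables (directed : bool) (q1 q2 : seq (vertex G)).
Hypotheses (l1 : links (@arc G) s1 t1 (s1 :: q1))
           (l2 : links (@arc G) s2 t2 (s2 :: q2)).
Hypothesis dis : [disjoint s1 :: q1 & s2 :: q2].

Local Notation r := (root gadget).

Definition link_arcs (x : vertex G) q : seq (vertex gadget * vertex gadget) :=
  [seq (old a.1, old a.2) | a <- zip (x :: q) q].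

(** The parent of terminal number [j], for [j > 0]; the value at [0] is junk. *)
Definition hook (j : nat) : vertex gadget :=
  if j == 1 then old s2 else if j == 2 then old t2 else
  if j <= c.+2 then old t1 else r.

Definition tree_arcs : seq (vertex gadget * vertex gadget) :=
  ((r, old s1) :: link_arcs s1 q1) ++ ((r, old s2) :: link_arcs s2 q2) ++
  [seq (hook (lift ord0 j), new (lift ord0 j)) | j <- enum 'I_K].

Definition tree_of_paths : {set vertex gadget * vertex gadget} :=
  [set a in tree_arcs].

Lemma unzip2_link_arcs x q : unzip2 (link_arcs x q) = map old q.
Proof.
have /= e := unzip2_zip_behead (x :: q).
by rewrite -[in RHS]e /unzip2 -!map_comp.
Qed.

Lemma unzip2_tree_arcs :
  unzip2 tree_arcs =
  map old ((s1 :: q1) ++ (s2 :: q2)) ++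
  [seq new (lift ord0 j) | j <- enum 'I_K].
Proof.
rewrite /tree_arcs /unzip2 !map_cat /= -!/(unzip2 _) !unzip2_link_arcs -catA /=.
by rewrite /unzip2 -map_comp.
Qed.

(** This serves twice: parents are unique, and the arcs of the list are distinct, so that a sum over
    the set is a sum over the list. *)
Lemma uniq_unzip2_tree_arcs : uniq (unzip2 tree_arcs).
Proof.
rewrite unzip2_tree_arcs cat_uniq map_inj_uniq; last exact: old_inj.
rewrite map_inj_uniq ?enum_uniq ?andbT; last by move=> i j /new_inj /lift_inj.
apply/andP; split; last first.
  by apply/hasPn=> _ /mapP[j _ ->]; apply/mapP=> -[x _ /eqP]; rewrite eq_sym old_new.
have /and4P[_ _ _ u1] := l1; have /and4P[_ _ _ u2] := l2.
rewrite cat_uniq u1 u2 andbT; apply/hasPn=> x x2; apply/negP => x1.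
by move/pred0P/(_ x): dis; rewrite /= [x \in _]x1 [x \in _]x2.
Qed.

Lemma tree_of_pathsP u v : (u, v) \in tree_of_paths ->
  [\/ u = r /\ v = old s1, u = r /\ v = old s2,
      (exists x y, [/\ u = old x, v = old y, arc x y &
         (x \in s1 :: q1 /\ y \in q1) \/ (x \in s2 :: q2 /\ y \in q2)])
    | exists j, [/\ j != ord0, u = hook j & v = new j]].
Proof.
rewrite inE mem_cat => /orP[|]; [|rewrite mem_cat => /orP[|]].
- rewrite inE => /orP[/eqP[-> ->]|/mapP[[x y] xy [-> ->]]]; first by constructor 1.
  constructor 3; exists x, y; split=> //; first exact: (links_zip l1 xy).
  by left; have := mem_zip xy.
- rewrite inE => /orP[/eqP[-> ->]|/mapP[[x y] xy [-> ->]]]; first by constructor 2.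
  constructor 3; exists x, y; split=> //; first exact: (links_zip l2 xy).
  by right; have := mem_zip xy.
- by case/mapP=> j _ [-> ->]; constructor 4; exists (lift ord0 j).
Qed.

Local Notation con := (connect (arc_rel tree_of_paths)).

Lemma tree_of_paths_functional u u' v :
  (u, v) \in tree_of_paths -> (u', v) \in tree_of_paths -> u = u'.
Proof.
rewrite !in_set; have := uniq_unzip2_tree_arcs.
elim: tree_arcs => [//|a s ih] /= /andP[as_ us]; rewrite !inE.
case/orP=> [/eqP ea|us1] /orP[/eqP ea'|us2]; last exact: ih.
- by move: ea'; rewrite -ea => -[->].
- by move: as_; rewrite -ea (map_f snd us2).
- by move: as_; rewrite -ea' (map_f snd us1).
Qed.

Lemma tree_of_paths_root u : (u, r) \notin tree_of_paths.
Proof.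
apply/negP => /tree_of_pathsP[[_ /eqP]|[_ /eqP]|[x [y [_ /eqP]]]|[j [j0 _]]];
  rewrite ?new_old // => /new_inj ej.
by rewrite -ej eqxx in j0.
Qed.

Let con_link x q :
  {subset link_arcs x q <= tree_arcs} -> (r, old x) \in tree_arcs ->
  {in x :: q, forall y, con r (old y)}.
Proof.
move=> sub rx y yq; apply: (@connect_trans _ _ (old x)).
  by apply: connect1; rewrite /arc_rel in_set.
have p : path (arc_rel tree_of_paths) (old x) (map old q).
  rewrite path_map; apply: sub_path (path_zip x q) => u v uv.
  by rewrite /= /arc_rel in_set; apply: sub; apply/mapP; exists (u, v).
by apply: (path_connect p); apply: (map_f old yq).
Qed.

Let con_link1 : {in s1 :: q1, forall y, con r (old y)}.
Proof.
by apply: con_link => [a h|]; rewrite /tree_arcs !(mem_cat, inE) ?h ?eqxx ?orbT.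
Qed.

Let con_link2 : {in s2 :: q2, forall y, con r (old y)}.
Proof.
by apply: con_link => [a h|]; rewrite /tree_arcs !(mem_cat, inE) ?h ?eqxx ?orbT.
Qed.

Let t1_link : t1 \in s1 :: q1.
Proof. by have /and4P[_ _ /eqP <- _] := l1; apply: mem_last. Qed.

Let t2_link : t2 \in s2 :: q2.
Proof. by have /and4P[_ _ /eqP <- _] := l2; apply: mem_last. Qed.

Lemma hook_arc j : j != ord0 -> (hook j, new j) \in tree_of_paths.
Proof.
case: (unliftP ord0 j) => [i|] -> // _; rewrite in_set /tree_arcs mem_cat.
rewrite mem_cat [X in _ || (_ || X)](_ : _ = true) ?orbT //.
by apply/mapP; exists i; rewrite ?mem_enum.
Qed.

Lemma tree_of_paths_connect u v : (u, v) \in tree_of_paths -> con r v.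
Proof.
move=> uv; apply: connect_trans (connect1 uv).
case/tree_of_pathsP: (uv) => [[-> _]|[-> _]|[x [y [-> _ _ h]]]|[j [j0 -> _]]] //.
- by case: h => -[? _]; [apply: con_link1 | apply: con_link2].
- rewrite /hook; case: ifP => _; first by apply: con_link2; rewrite mem_head.
  case: ifP => _; first exact: con_link2.
  by case: ifP => _ //; apply: con_link1.
Qed.

(** A label for the child of the root above [v]: 1 for [s1], 2 for [s2], and its own number, larger
    than [c + 2], for a terminal hung from the root. It is constant on subtrees that avoid the root,
    so a capacity is checked by counting the terminals with one label. The values at the root and at
    old vertices off the paths are junk. *)
Definition branch (v : vertex gadget) : nat :=
  match split v with
  | inl x => if x \in s1 :: q1 then 1 else 2
  | inr j => if (j == 1 :> nat) || (j == 2 :> nat) then 2 else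
             if j <= c.+2 then 1 else j
  end.

Let notin1 x : x \in s2 :: q2 -> (x \in s1 :: q1) = false.
Proof.
by move=> h2; apply/negP => h1; move/pred0P/(_ x): dis; rewrite /= [x \in _]h1 [x \in _]h2.
Qed.

Lemma branch_arc u v : (u, v) \in tree_of_paths -> u != r -> branch v = branch u.
Proof.
case/tree_of_pathsP=> [[-> _]|[-> _]|[x [y [-> -> _ h]]]|[j [j0 -> ->]]];
  rewrite ?eqxx // /branch ?split_old ?split_new.
- case: h => -[hx hy] _; first by rewrite hx in_cons hy orbT.
  by rewrite !notin1 // in_cons hy orbT.
- rewrite /hook; case: (nat_of_ord j =P 1) => _ /=.
    by rewrite split_old notin1 ?mem_head.
  case: (nat_of_ord j =P 2) => _ /=; first by rewrite split_old notin1.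
  by case: ifP => _; rewrite ?eqxx // split_old t1_link.
Qed.

Lemma branch_connect u v : u != r -> con u v -> branch v = branch u.
Proof.
move=> ur /connectP[p up ->]; elim: p u ur up => //= w p ih u ur /andP[uw wp].
rewrite ih //; first exact: branch_arc ur.
by apply: contraTneq uw => ->; apply: tree_of_paths_root.
Qed.

(** The label 1 belongs to the [c] pendants, the label 2 to two terminals, which needs [2 <= c], and
    any other label to at most one. *)
Lemma card_branch l : #|[set t in terminals gadget | branch t == l]| <= c.
Proof.
pose B : {set vertex gadget} :=
  if l == 1 then pendants else
  if l == 2 then [set new new1; new new2] else [set new (inord l)].
have cB : #|B| <= c.
  rewrite /B; case: ifP => _; first by rewrite card_pendants.
  by case: ifP => _; rewrite ?cards1 ?cards2; [case: eqVneq => _ /=|]; lia.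
apply: leq_trans (subset_leq_card _) cB; apply/subsetP=> v; rewrite inE.
case: (vertexP v) => [x|j]; first by rewrite old_terminal.
rewrite new_terminal /branch split_new => /andP[j0 /eqP jl].
have j1 : 0 < j by rewrite lt0n.
rewrite /B -jl; case: (nat_of_ord j =P 1) => [e|n1] /=.
  by rewrite (_ : j = new1) ?inE ?eqxx //; apply: val_inj; rewrite /= val_new1.
case: (nat_of_ord j =P 2) => [e|n2] /=.
  by rewrite (_ : j = new2) ?inE ?eqxx ?orbT //; apply: val_inj; rewrite /= val_new2.
case: (leqP j c.+2) => h /=; first by rewrite new_pendant; lia.
by rewrite (introF eqP n1) (introF eqP n2) inE inord_val.
Qed.

Lemma reached_arc x y : reached x -> arc x y -> reached y.
Proof.
move=> /hasP[z zs zx] xy; apply/hasP; exists z => //.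
by apply: connect_trans zx (connect1 xy).
Qed.

Lemma link_reached (e : rel (vertex G)) x y mu z : subrel e (@arc G) ->
  reached x -> links e x y mu -> z \in mu -> reached z.
Proof.
move=> ea; case: mu => // w q Rx /and4P[/eqP-> xq _ _].
elim: q x Rx xq => [|v q ih] x Rx /=; first by rewrite inE => _ /eqP->.
move=> /andP[/ea xv vq]; rewrite inE => /orP[/eqP->//|].
by apply: ih => //; apply: reached_arc xv.
Qed.

Lemma tree_of_paths_feasible :
  @feasible (ml_cap_steiner_tree directed) gadget tree_of_paths.
Proof.
split.
- move=> [u v] /tree_of_pathsP; rewrite /arcs unfold_in /=.
  case=> [[-> ->]|[-> ->]|[x [y [-> -> xy h]]]|[j [j0 -> ->]]].
  + by rewrite arc_new_old /= inE eqxx.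
  + by rewrite arc_new_old /= !inE eqxx orbT.
  + rewrite arc_old_old xy /=; case: h => -[hx _].
      by apply: link_reached l1 hx => //; rewrite /reached /= connect0.
    by apply: link_reached l2 hx => //; rewrite /reached /= connect0 orbT.
  + have j1 : 0 < j by rewrite lt0n.
    rewrite /hook; case: eqP => [e1|n1]; first by rewrite gadget_arcE e1 /= !inE eqxx.
    case: eqP => [e2|n2]; first by rewrite gadget_arcE e2 /= !inE eqxx.
    case: leqP => h; first by rewrite gadget_arcE attached_t1 // j1.
    by rewrite arc_new_new /spoke /= h.
- exact: arborescence_intro tree_of_paths_functional tree_of_paths_root
           tree_of_paths_connect.
- apply/subsetP=> v; case: (vertexP v) => [x|j]; first by rewrite old_terminal.
  by rewrite new_terminal => /hook_arc; apply: head_in_tree.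
- move=> u v uv; apply: leq_trans (card_branch (branch v)).
  apply: subset_leq_card; apply/subsetP=> w; rewrite !inE => /andP[-> vw].
  rewrite (branch_connect _ vw) ?eqxx //.
  by apply: contraTneq uv => ->; apply: tree_of_paths_root.
Qed.

Lemma tree_of_paths_value :
  @value (ml_cap_steiner_tree directed) gadget tree_of_paths =
  (path_length (s1 :: q1) + path_length (s2 :: q2))%R.
Proof.
rewrite /value /= (eq_bigl (mem tree_arcs)) => [|a]; last by rewrite in_set.
rewrite -big_uniq /=; last exact: map_uniq uniq_unzip2_tree_arcs.
rewrite /tree_arcs big_cat big_cons big_cat big_cons /= !big_map.
rewrite [X in (_ + (_ + X))%R]big1 => [|j _]; last by rewrite len_new.
rewrite !len_new' !GRing.add0r GRing.addr0.
by congr (_ + _)%R; apply: eq_bigr => a _; rewrite len_old_old.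
Qed.

End PathsToTree.

(** * Connectivity of the new instance *)

Lemma gadget_connect_old x y : reached x -> connect (@arc G) x y ->
  connect gadget_arc (old x) (old y).
Proof.
move=> Rx /connectP[p xp ->]; elim: p x Rx xp => [|z p ih] x Rx //= /andP[xz zp].
apply: connect_trans (ih z _ zp); last exact: reached_arc xz.
by apply: connect1; rewrite arc_old_old xz.
Qed.

(** Whatever the arcs of [G], the chain [root], [s2], [new1], [t1], [new2], [t2] reaches the ends
    other than [s1]; this is what the links from [new1] and [new2] to [t1] are for. *)
Lemma gadget_connect_root v : connect gadget_arc (root gadget) v.
Proof.
have r0 : root gadget = new ord0 by [].
have rs1 : connect gadget_arc (root gadget) (old s1).
  by apply: connect1; rewrite r0 arc_new_old /= inE eqxx.
have rs2 : connect gadget_arc (root gadget) (old s2).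
  by apply: connect1; rewrite r0 arc_new_old /= !inE eqxx orbT.
have rt1 : connect gadget_arc (root gadget) (old t1).
  apply: connect_trans rs2 _; apply: (@connect_trans _ _ (new new1)).
    by apply: connect1; rewrite arc_old_new val_new1 /= !inE eqxx.
  by apply: connect1; rewrite arc_new_old val_new1 /= !inE eqxx orbT.
have rt2 : connect gadget_arc (root gadget) (old t2).
  apply: connect_trans rt1 _; apply: (@connect_trans _ _ (new new2)).
    by apply: connect1; rewrite arc_old_new val_new2 /= !inE eqxx orbT.
  by apply: connect1; rewrite arc_new_old val_new2 /= !inE eqxx.
case: (vertexP v) => [x|j].
  have [/hasP[z zs zx]|NR] := boolP (reached x); last first.
    by apply: connect1; rewrite r0 arc_new_old /= NR orbT.
  have Rz : reached z by apply/hasP; exists z.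
  apply: connect_trans (gadget_connect_old Rz zx).
  by move: zs; rewrite !inE => /or4P[] /eqP->.
have [->//|j0] := eqVneq j ord0; have j1 : 0 < j by rewrite lt0n.
have [h|h] := leqP j c.+2; last first.
  by apply: connect1; rewrite r0 arc_new_new /spoke /= h.
by apply: connect_trans rt1 (connect1 _); rewrite arc_old_new attached_t1 ?j1.
Qed.

Lemma gadget_is_cst_inst directed :
  is_wgraph directed G -> is_cst_inst directed gadget.
Proof.
move=> [irr len0 und]; have gsym : ~~ directed -> symmetric gadget_arc.
  move=> /und[sym _] u v; case: (vertexP u) => x; case: (vertexP v) => y;
    rewrite !gadget_arcE //; last by rewrite orbC.
  (* The filter looks at the tail only; along a symmetric arc both ends are reached or neither
     is. *)
  rewrite [arc y x]sym; case xy: (arc x y) => //=; apply/idP/idP => h.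
    exact: reached_arc h xy.
  by apply: reached_arc h _; rewrite sym.
split.
- split.
  + move=> u; case: (vertexP u) => x; rewrite /= gadget_arcE ?irr //.
    by rewrite orbb /spoke; case: eqP => //= ->.
  + move=> u v; case: (vertexP u) => x; last by rewrite /= len_new'.
    case: (vertexP v) => y; last by rewrite /= len_new.
    by rewrite /= gadget_arcE len_old_old => /andP[/len0].
  + move=> nd; split=> [|u v]; first exact: gsym.
    case: (vertexP u) => x; last by rewrite /= len_new len_new'.
    case: (vertexP v) => y; last by rewrite /= len_new len_new'.
    rewrite /= gadget_arcE !len_old_old => /andP[xy _].
    by have [_ ->] := und nd.
- case: directed {und} gsym => gsym; first exact: gadget_connect_root.
  move=> u v; apply: connect_trans (gadget_connect_root v).
  rewrite (sym_connect_sym (gsym isT)); exact: gadget_connect_root.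
- by move=> u v _ /=; lia.
- by [].
- by rewrite card_terminals new_terminal eqxx; split=> //; lia.
Qed.

End Gadget.

(** * Membership and fixed iteration as programs *)

Lemma tsize_fst x : tsize (tfst x) <= tsize x.
Proof. by case: x => //= y z; lia. Qed.

Lemma tsize_snd x : tsize (tsnd x) <= tsize x.
Proof. by case: x => //= y z; lia. Qed.

Ltac polyfun_tac :=
  repeat first
    [ exact: polyfun_const | exact: polyfun_id | eassumption
    | apply: polyfun_fst | apply: polyfun_snd | apply: polyfun_node
    | apply: polyfun_if | apply: polyfun_eq ].

Definition tmem_step (e l s : tree) :=
  if truth (tbool (e == tfst l)) then ttrue else s.
Definition tmem (x l : tree) := tfold (tmem_step x) l Leaf.

Lemma polyfun_mem f g :
  polyfun f -> polyfun g -> polyfun (fun x => tmem (f x) (g x)).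
Proof.
move=> hf hg; apply: (polyfun_fold (step := tmem_step)) => //.
- by rewrite /tmem_step; polyfun_tac.
- exists 3, 1 => e l s; rewrite /tmem_step expn1.
  by case: ifP => _ /=; have := tsize_gt0 l; lia.
- exact: polyfun_const.
Qed.

Lemma tmemE x l : truth (tmem x (code_seq l)) = (x \in l).
Proof.
rewrite /tmem; have -> : (x \in l) = truth Leaf || (x \in l) by [].
elim: l Leaf => [|y l ih] s /=; first by rewrite orbF.
by rewrite ih /tmem_step truth_tbool in_cons /=; case: eqP; rewrite ?orbT.
Qed.

(** The list [js] belongs to the program, not to the input: the iteration is unrolled into a
    composition, so no growth condition is imposed. It is applied to a list of length [K + 1], which
    is constant. *)
Lemma polyfun_foldr (J : Type) (js : seq J) (step : J -> tree -> tree -> tree) f g :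
  (forall j, polyfun (fun z => step j (tfst z) (tsnd z))) ->
  polyfun f -> polyfun g ->
  polyfun (fun x => foldr (fun j s => step j (f x) s) (g x) js).
Proof.
move=> hs hf hg; elim: js => //= j js ih.
exact: (polyfun_comp (hs j) (polyfun_node hf ih)).
Qed.

(** * Reachability *)

(** The head of the arc is added even when already listed. Repetitions are harmless, and the growth
    of a whole round is still bounded in terms of the arc list alone, as a nested loop requires. *)
Definition reach_step (e l s : tree) :=
  if truth (tmem (tfst (tfst (tfst l))) s) then Node (tsnd (tfst (tfst l))) s
  else s.
Definition reach_round (e l s : tree) := tfold (reach_step Leaf) e s.
Definition treach (n l s : tree) := tfold (reach_round l) n s.

Lemma tsize_reach_step e l s : tsize (reach_step e l s) <= tsize s + 2 * tsize l.
Proof.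
rewrite /reach_step; case: ifP => _ /=; last by rewrite leq_addr.
have := tsize_snd (tfst (tfst l)); have := tsize_fst (tfst l).
have := tsize_fst l; have := tsize_gt0 l; lia.
Qed.

Lemma polyfun_reach f g h : polyfun f -> polyfun g -> polyfun h ->
  polyfun (fun x => treach (f x) (g x) (h x)).
Proof.
move=> hf hg hh; apply: (polyfun_fold (step := reach_round)) => //.
  apply: (polyfun_fold (step := reach_step) (e := fun=> Leaf)); polyfun_tac.
    by apply: polyfun_mem; polyfun_tac.
  exists 2, 1 => e l s; apply: leq_trans (tsize_reach_step e l s) _.
  by rewrite expn1; lia.
exists 2, 2 => e l s.
apply: leq_trans (@tsize_tfold _ (tsize e) (2 * tsize e) _ _ _ _) _ => //.
  by move=> l' s' l'e; apply: leq_trans (tsize_reach_step _ _ _) _; lia.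
by rewrite !expnS expn0; nia.
Qed.

Section Codes.

Variable n : nat.
Implicit Types (x y : 'I_n) (a : 'I_n * 'I_n).

Lemma code_unary_inj : injective code_unary.
Proof. by elim=> [|i ih] [|j] //= [/ih->]. Qed.

Lemma code_vertex_inj : injective (@code_vertex n).
Proof. by move=> x y /code_unary_inj/val_inj. Qed.

Definition code_vertices (l : seq 'I_n) := code_seq [seq code_vertex x | x <- l].

Lemma tmem_vertices x l : truth (tmem (code_vertex x) (code_vertices l)) = (x \in l).
Proof. by rewrite tmemE mem_map //; apply: code_vertex_inj. Qed.

Variables (e : rel 'I_n) (w : 'I_n * 'I_n -> tree) (s : seq ('I_n * 'I_n)).
Hypothesis se : s =i (fun a => e a.1 a.2).

Definition code_arcs := code_seq [seq Node (code_pair a) (w a) | a <- s].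

Definition round (l : seq 'I_n) :=
  foldl (fun l a => if a.1 \in l then a.2 :: l else l) l s.

Lemma reach_round_round c l :
  reach_round code_arcs c (code_vertices l) = code_vertices (round l).
Proof.
rewrite /reach_round /code_arcs /round; elim: s l => //= a s' ih l.
rewrite -ih; congr tfold.
by rewrite /reach_step /= tmem_vertices; case: ifP.
Qed.

Lemma treach_iter m l :
  treach (code_unary m) code_arcs (code_vertices l) =
  code_vertices (iter m round l).
Proof.
rewrite /treach /code_unary; elim: m l => // m ih l.
by rewrite iterSr -ih /= reach_round_round.
Qed.

Lemma sub_round l : {subset l <= round l}.
Proof.
rewrite /round; elim: s l => [|a s' ih] l x xl //=; apply: ih.
by case: ifP => // _; rewrite inE xl orbT.
Qed.

Lemma round_arc l x y : x \in l -> e x y -> y \in round l.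
Proof.
move=> xl xy; have : (x, y) \in s by rewrite se.
rewrite /round; elim: s l xl => [//|a s' ih] l xl /=.
have sub l' : {subset l' <= foldl (fun l a => if a.1 \in l then a.2 :: l else l) l' s'}.
  elim: s' {ih} l' => [|b s' ih] l' z zl //=; apply: ih.
  by case: ifP => // _; rewrite inE zl orbT.
rewrite inE => /orP[/eqP <-|/ih]; first by rewrite xl; apply: sub; rewrite mem_head.
by apply; case: ifP => // _; rewrite inE xl orbT.
Qed.

Lemma round_connect l z : z \in round l -> has (fun x => connect e x z) l.
Proof.
have : {subset s <= (fun a => e a.1 a.2)} by move=> a; rewrite se.
rewrite /round; elim: s l => /= [|a s' ih] l es.
  by move=> zl; apply/hasP; exists z.
have es' : {subset s' <= (fun a => e a.1 a.2)}.
  by move=> b bs; apply: es; rewrite inE bs orbT.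
case: ifP => al /(ih _ es') //= /orP[az|//].
apply/hasP; exists a.1 => //; apply: connect_trans az; apply: connect1.
by apply: (es a); rewrite mem_head.
Qed.

Lemma iter_round_connect m l y :
  y \in iter m round l -> has (fun x => connect e x y) l.
Proof.
elim: m y => [|m ih] y /=; first by move=> yl; apply/hasP; exists y.
case/round_connect/hasP=> z /ih/hasP[x xl xz] zy.
by apply/hasP; exists x => //; apply: connect_trans zy.
Qed.

(** A round may follow several arcs of the path, depending on the order of [s], but it surely
    follows one. *)
Lemma iter_round_path m l x p :
  x \in l -> path e x p -> size p <= m -> last x p \in iter m round l.
Proof.
elim: m p l x => [|m ih] [|z p] l x xl //=.
  by move=> _ _; apply: sub_round; apply: (ih [::] l x).
move=> /andP[xz zp] pm; rewrite -iterS iterSr.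
by apply: ih zp pm; apply: round_arc xz.
Qed.

Lemma iter_round l : iter n round l =i (fun y => has (fun x => connect e x y) l).
Proof.
move=> y; apply/idP/idP; first exact: iter_round_connect.
(* A simple path has fewer than [n] arcs, so [n] rounds suffice. *)
case/hasP=> x xl /connectP[p0 /shortenP[p xp up _ {p0}] ->].
apply: iter_round_path => //; have := card_uniqP up => /= h.
by apply: leq_trans (leqnSn _) _; rewrite -h -[n in _ <= n]card_ord max_card.
Qed.

End Codes.

(** * The transformation as a program *)

Section Transformation.

Variables (K c : nat).

Definition in_order (d : tree) := tfst d.
Definition in_arcs (d : tree) := tfst (tsnd d).
Definition in_ends (d : tree) := tfst (tsnd (tsnd d)).
Definition in_s1 (d : tree) := tfst (tfst (in_ends d)).
Definition in_t1 (d : tree) := tsnd (tfst (in_ends d)).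
Definition in_s2 (d : tree) := tfst (tfst (tsnd (in_ends d))).
Definition in_t2 (d : tree) := tsnd (tfst (tsnd (in_ends d))).

(** The reached vertices are computed once and then travel with the input. *)
Definition reach_env (d : tree) : tree :=
  Node d (treach (in_order d) (in_arcs d)
    (code_seq [:: in_s1 d; in_s2 d; in_t1 d; in_t2 d])).

(** In unary, the name of new vertex number [j] is the code of the order of the graph with [j] more
    leaves. *)
Definition tnew (j : nat) (e : tree) : tree :=
  iter j (Node Leaf) (in_order (tfst e)).

Definition tattached (j : nat) (e x : tree) : tree :=
  let d := tfst e in
  match j with
  | 0 => if truth (tbool (x == in_s1 d)) then ttrue else
         if truth (tbool (x == in_s2 d)) then ttrue else
         if truth (tmem x (tsnd e)) then Leaf else ttrue
  | 1 => if truth (tbool (x == in_s2 d)) then ttrue else tbool (x == in_t1 d)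
  | 2 => if truth (tbool (x == in_t2 d)) then ttrue else tbool (x == in_t1 d)
  | _ => if truth (tbool (j <= c.+2)) then tbool (x == in_t1 d) else Leaf
  end.

Definition edge_step (j : nat) (z s : tree) : tree :=
  if truth (tattached j (tfst z) (tsnd z))
  then Node (Node (tnew j (tfst z)) (tsnd z)) s else s.

(** The loop runs over the unary code of the order: when [l] codes [m], its tail [tsnd l] is the
    name of vertex [m - 1]. *)
Definition vertex_step (e l s : tree) : tree :=
  foldr (fun j s => edge_step j (Node e (tsnd l)) s) s (iota 0 K.+1).

Definition tspokes (e : tree) : tree :=
  code_seq [seq f e | f <- [seq (fun e => Node (tnew 0 e) (tnew j e))
                           | j <- iota 0 K.+1 & c.+2 < j]].

Definition tedges (e : tree) : tree :=
  tfold (vertex_step e) (in_order (tfst e)) (tspokes e).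

Definition weight : tree := Node (code_rat 0%R) (code_nat c).

Definition forth_step (e l s : tree) : tree := Node (Node (tfst l) weight) s.

Definition back_step (e l s : tree) : tree :=
  Node (Node (Node (tsnd (tfst l)) (tfst (tfst l))) weight) s.

Definition kept_step (e l s : tree) : tree :=
  if truth (tmem (tfst (tfst (tfst l))) e)
  then Node (Node (tfst (tfst l)) (Node (tsnd (tfst l)) (code_nat c))) s else s.

Definition out_arcs (e : tree) : tree :=
  tfold (forth_step Leaf) (tedges e)
    (tfold (back_step Leaf) (tedges e)
      (tfold (kept_step (tsnd e)) (in_arcs (tfst e)) Leaf)).

Definition out_terminals (e : tree) : tree :=
  code_seq [seq f e | f <- [seq tnew j | j <- iota 0 K.+1 & 0 < j]].

Definition out_inst (e : tree) : tree :=
  Node (tnew K.+1 e) (Node (out_arcs e)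
    (Node (out_terminals e) (Node (tnew 0 e) Leaf))).

Lemma polyfun_tnew j f : polyfun f -> polyfun (fun x => tnew j (f x)).
Proof.
by move=> hf; rewrite /tnew; elim: j => [|j ih] /=; rewrite /in_order; polyfun_tac.
Qed.

Lemma tsize_tnew j e : tsize (tnew j e) <= 2 * j + tsize e.
Proof.
rewrite /tnew; elim: j => [|j ih] /=; last by lia.
by rewrite /in_order; have := tsize_fst e; have := tsize_fst (tfst e); lia.
Qed.

Lemma polyfun_attached j f g : polyfun f -> polyfun g ->
  polyfun (fun x => tattached j (f x) (g x)).
Proof.
move=> hf hg; rewrite /tattached /in_s1 /in_s2 /in_t1 /in_t2 /in_ends.
by case: j => [|[|[|j]]]; polyfun_tac; apply: polyfun_mem; polyfun_tac.
Qed.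

Lemma polyfun_code_seq_map (J : Type) (g : J -> tree -> tree) (js : seq J) f :
  (forall j, polyfun (g j)) -> polyfun f ->
  polyfun (fun x => code_seq [seq h (f x) | h <- [seq g j | j <- js]]).
Proof.
move=> hg hf; elim: js => [|j js ih] /=; first exact: polyfun_const.
by apply: polyfun_node => //; apply: polyfun_comp (hg j) hf.
Qed.

Lemma tsize_foldr (J : Type) (step : J -> tree -> tree) w js s :
  (forall j s, tsize (step j s) <= tsize s + w j) ->
  tsize (foldr step s js) <= tsize s + \sum_(j <- js) w j.
Proof.
move=> h; elim: js => [|j js ih] /=; first by rewrite big_nil addn0.
by rewrite big_cons; apply: leq_trans (h _ _) _; lia.
Qed.

Lemma polyfun_edges f : polyfun f -> polyfun (fun x => tedges (f x)).
Proof.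
move=> hf; apply: (polyfun_fold (step := vertex_step)) => //.
- rewrite /vertex_step; apply: polyfun_foldr; rewrite /edge_step; polyfun_tac => j.
  apply: polyfun_if; polyfun_tac; last by apply: polyfun_tnew; polyfun_tac.
  by apply: polyfun_attached; polyfun_tac.
- exists (\sum_(j <- iota 0 K.+1) (2 * j + 3)), 1 => e l s; rewrite expn1.
  rewrite /vertex_step big_distrl; apply: tsize_foldr => j {}s.
  rewrite /edge_step; case: ifP => _ /=; last by rewrite leq_addr.
  have := tsize_tnew j e; have := tsize_snd l; have := tsize_gt0 e.
  by have := tsize_gt0 l; nia.
- by rewrite /in_order; polyfun_tac.
- apply: polyfun_code_seq_map => // j.
  by apply: polyfun_node; apply: polyfun_tnew; apply: polyfun_id.
Qed.

Lemma polyfun_out_arcs : polyfun out_arcs.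
Proof.
have he : polyfun tedges by exact: (polyfun_edges polyfun_id).
apply: (polyfun_fold (step := forth_step) (e := fun=> Leaf)) => //.
- by rewrite /forth_step; polyfun_tac.
- exists (2 + tsize weight), 1 => e l s; rewrite /forth_step /= expn1.
  by have := tsize_fst l; have := tsize_gt0 e; have := tsize_gt0 l; nia.
- exact: polyfun_const.
apply: (polyfun_fold (step := back_step) (e := fun=> Leaf)) => //.
- by rewrite /back_step; polyfun_tac.
- exists (4 + tsize weight), 1 => e l s; rewrite /back_step /= expn1.
  have := tsize_fst (tfst l); have := tsize_snd (tfst l).
  by have := tsize_fst l; have := tsize_gt0 e; have := tsize_gt0 l; nia.
- exact: polyfun_const.
apply: (polyfun_fold (step := kept_step) (e := tsnd)); rewrite /in_arcs; polyfun_tac.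
- by rewrite /kept_step; polyfun_tac; apply: polyfun_mem; polyfun_tac.
- exists (4 + tsize (code_nat c)), 1 => e l s; rewrite /kept_step /= expn1.
  case: ifP => _; last by rewrite leq_addr.
  have /= := tsize_fst (tfst l); have := tsize_snd (tfst l).
  by have := tsize_fst l; have := tsize_gt0 e; have := tsize_gt0 l; nia.
Qed.

Lemma polyfun_transformation : polyfun (fun d => out_inst (reach_env d)).
Proof.
apply: (polyfun_comp (g := out_inst)).
  rewrite /out_inst /out_terminals; apply: polyfun_node; first exact: (polyfun_tnew _ polyfun_id).
  apply: polyfun_node; first exact: polyfun_out_arcs.
  apply: polyfun_node.
    by apply: polyfun_code_seq_map; [move=> j; exact: (polyfun_tnew j polyfun_id) | exact: polyfun_id].
  by apply: polyfun_node; polyfun_tac; exact: (polyfun_tnew _ polyfun_id).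
rewrite /reach_env /in_s1 /in_s2 /in_t1 /in_t2 /in_ends /in_order /in_arcs /=.
by polyfun_tac; apply: polyfun_reach; polyfun_tac.
Qed.

End Transformation.

(** * Tracing paths back *)

Definition parent_step (e l s : tree) : tree :=
  if truth (tbool (e == tsnd (tfst l))) then tfst (tfst l) else s.

Definition tparent (v S : tree) : tree := tfold (parent_step v) S Leaf.

Definition trace_step (e l s : tree) : tree :=
  if truth (tbool (tfst s == tsnd e)) then s
  else Node (tparent (tfst s) (tfst e)) s.

(** The arc list plays two roles: in the environment it is the table of parents, and as the loop
    list it is a mere counter, a path having no more arcs than the tree. Once [a] is at the front,
    the remaining turns change nothing. *)
Definition trace (S a b : tree) : tree :=
  tfold (trace_step (Node S a)) S (Node b Leaf).

Definition out_paths (z : tree) : tree :=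
  code_seq [:: trace (tsnd z) (in_s1 (tfst z)) (in_t1 (tfst z));
               trace (tsnd z) (in_s2 (tfst z)) (in_t2 (tfst z))].

Lemma tsize_parent_step e l s : tsize (parent_step e l s) <= tsize s + tsize l.
Proof.
rewrite /parent_step; case: ifP => _; last by rewrite leq_addr.
by have := tsize_fst (tfst l); have := tsize_fst l; lia.
Qed.

Lemma polyfun_trace f g h : polyfun f -> polyfun g -> polyfun h ->
  polyfun (fun x => trace (f x) (g x) (h x)).
Proof.
move=> hf hg hh.
apply: (polyfun_fold (step := trace_step) (e := fun x => Node (f x) (g x)));
  polyfun_tac.
- rewrite /trace_step; polyfun_tac.
  apply: (polyfun_fold (step := parent_step)); rewrite /parent_step; polyfun_tac.
  exists 1, 1 => e l s; apply: leq_trans (tsize_parent_step _ _ _) _.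
  by rewrite expn1; lia.
- exists 2, 2 => e l s; rewrite /trace_step; case: ifP => _ /=.
    by rewrite leq_addr.
  have := @tsize_tfold (parent_step (tfst s)) (tsize (tfst e)) (tsize (tfst e))
    (tfst e) Leaf.
  rewrite -/(tparent _ _) => /(_ _ _)/= h1.
  have {}h1 : tsize (tparent (tfst s) (tfst e)) <= 1 + tsize (tfst e) * tsize (tfst e).
    apply: h1 => // l' s' h'; apply: leq_trans (tsize_parent_step _ _ _) _.
    by rewrite leq_add2l.
  have := tsize_fst e; have := tsize_gt0 l; have := tsize_gt0 e.
  by rewrite !expnS expn0; nia.
Qed.

Lemma polyfun_out_paths : polyfun out_paths.
Proof.
rewrite /out_paths /= /in_s1 /in_s2 /in_t1 /in_t2 /in_ends.
by polyfun_tac; apply: polyfun_trace; polyfun_tac.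
Qed.

(** * Correctness of the transformation program *)

Lemma iter_code_unary j n : iter j (Node Leaf) (code_unary n) = code_unary (n + j).
Proof. by elim: j => [|j ih] /=; rewrite ?addn0 // ih addnS. Qed.

Section TransformationCorrect.

Variables (G : wgraph) (s1 s2 t1 t2 : vertex G) (K c : nat).
Variable s : seq (vertex G * vertex G).
Hypothesis ls : lists s (@arcs G).

Local Notation H := (gadget s1 s2 t1 t2 K c).
Local Notation old := (@old G s1 s2 t1 t2 K c).
Local Notation new := (@new G s1 s2 t1 t2 K c).
Local Notation vertexP := (@vertexP G s1 s2 t1 t2 K c).
Local Notation attached := (attached s1 s2 t1 t2 c).
Local Notation reached := (reached s1 s2 t1 t2).

Definition weight_code (a : vertex G * vertex G) := code_rat (len a.1 a.2).

Definition instance_code : tree :=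
  code_seq [:: code_unary (order G); code_arcs weight_code s;
     code_seq [seq code_pair a | a <- [:: (s1, t1); (s2, t2)]]].

Let sE : s =i (fun a => arc a.1 a.2). Proof. by case: ls. Qed.

Let R := iter (order G) (round s) [:: s1; s2; t1; t2].

Let R_reached x : (x \in R) = reached x.
Proof. by rewrite (iter_round sE). Qed.

Let env := reach_env instance_code.

Lemma reach_envE : env = Node instance_code (code_vertices R).
Proof.
by rewrite /env /reach_env -(treach_iter weight_code).
Qed.

Lemma tnewE (j : 'I_K.+1) : tnew j env = code_vertex (new j).
Proof. exact: iter_code_unary. Qed.

Lemma tattachedE j x : truth (tattached c j env (code_vertex x)) = attached j x.
Proof.
have eqc : forall y, (code_vertex x == code_vertex y) = (x == y).
  by move=> y; apply: inj_eq; apply: code_vertex_inj.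
rewrite reach_envE; case: j => [|[|[|j]]] /=;
  rewrite /in_s1 /in_s2 /in_t1 /in_t2 /= ?truth_tbool ?eqc ?inE.
- case: (x == s1) => //; case: (x == s2) => //=.
  by rewrite tmem_vertices R_reached; case: reached.
- by case: (x == s2); rewrite ?truth_tbool.
- by case: (x == t2); rewrite ?truth_tbool.
- by case: (_ <= _); rewrite ?truth_tbool.
Qed.

Definition code_pairs (l : seq (vertex H * vertex H)) :=
  code_seq [seq code_pair a | a <- l].

Definition edges_at (x : vertex G) : seq (vertex H * vertex H) :=
  [seq (new j, old x) | j : 'I_K.+1 <- enum 'I_K.+1 & attached j x].

Definition spokes : seq (vertex H * vertex H) :=
  [seq (new ord0, new j) | j : 'I_K.+1 <- enum 'I_K.+1 & c.+2 < j].

(** Each added edge occurs in one direction, from new to old or from the root to a terminal, so that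
    appending the reversed arcs creates no repetition. *)
Definition edges : seq (vertex H * vertex H) :=
  flatten [seq edges_at x | x <- enum 'I_(order G)] ++ spokes.

Lemma vertex_stepE x l :
  vertex_step K c env (Node Leaf (code_vertex x)) (code_pairs l) =
  code_pairs (edges_at x ++ l).
Proof.
rewrite /vertex_step -val_enum_ord foldr_map /edges_at.
elim: (enum _) => //= j js ->.
by rewrite /edge_step [truth _]tattachedE; case: ifP => //= _; rewrite tnewE.
Qed.

Lemma tspokesE : tspokes K c env = code_pairs spokes.
Proof.
rewrite /tspokes /code_pairs -val_enum_ord filter_map -!map_comp; congr code_seq.
by apply: eq_map => j; exact: (congr2 Node (tnewE ord0) (tnewE j)).
Qed.

Lemma tedgesE : tedges K c env = code_pairs edges.
Proof.
(* Indexing by natural numbers allows induction on [m]; out of range, [insub] fails and the list is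
   empty. *)
pose ea k := oapp edges_at [::] (insub k).
have tf m l : m <= order G -> tfold (vertex_step K c env) (code_unary m) (code_pairs l) =
    code_pairs (flatten [seq ea k | k <- iota 0 m] ++ l).
  elim: m l => // m ih l mn.
  rewrite [LHS]/= -/(code_unary m).
  have -> : vertex_step K c env (Node Leaf (code_unary m)) (code_pairs l) =
      code_pairs (ea m ++ l).
    by rewrite /ea insubT /= -vertex_stepE.
  rewrite ih; last exact: ltnW.
  by rewrite -[m.+1]addn1 iotaD map_cat flatten_cat /= cats0 -catA.
rewrite /tedges tspokesE tf // /edges -val_enum_ord -map_comp.
congr (code_pairs (flatten _ ++ _)); apply: eq_map => x.
by rewrite /ea /= valK.
Qed.

Definition gadget_code (a : vertex H * vertex H) : tree :=
  Node (code_pair a) (Node (code_rat (len a.1 a.2)) (code_nat c)).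

(** This is the order in which the three folds leave the arcs; each fold prepends, whence [catrev]
    and [rev]. *)
Definition gadget_arcs : seq (vertex H * vertex H) :=
  catrev edges (catrev [seq (a.2, a.1) | a <- edges]
    (rev [seq (old a.1, old a.2) | a <- s & reached a.1])).

Lemma edges_len a : a \in edges -> len a.1 a.2 = 0%R /\ len a.2 a.1 = 0%R.
Proof.
rewrite mem_cat => /orP[/flattenP[_ /mapP[x _ ->] /mapP[j _ ->]]|/mapP[j _ ->]];
  by rewrite /= ?len_new ?len_new'.
Qed.

Lemma out_arcsE :
  out_arcs K c env = code_seq [seq gadget_code a | a <- gadget_arcs].
Proof.
rewrite /out_arcs tedgesE.
have kept l acc :
    tfold (kept_step c (code_vertices R)) (code_arcs weight_code l)
      (code_seq [seq gadget_code a | a <- acc]) =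
    code_seq [seq gadget_code a |
      a <- catrev [seq (old a.1, old a.2) | a <- l & reached a.1] acc].
  rewrite /code_arcs; elim: l acc => //= a l ih acc.
  rewrite {2}/kept_step /= tmem_vertices R_reached; case: ifP => _; rewrite -ih //=.
  by rewrite /gadget_code /= len_old_old.
have back l acc : {subset l <= edges} ->
    tfold (back_step c Leaf) (code_pairs l)
      (code_seq [seq gadget_code a | a <- acc]) =
    code_seq [seq gadget_code a | a <- catrev [seq (a.2, a.1) | a <- l] acc].
  rewrite /code_pairs; elim: l acc => //= a l ih acc sub.
  have [_ e] := edges_len (sub a (mem_head _ _)).
  rewrite -ih => [|b bl]; last by apply: sub; rewrite inE bl orbT.
  by rewrite /back_step /= /gadget_code e.
have forth l acc : {subset l <= edges} ->
    tfold (forth_step c Leaf) (code_pairs l)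
      (code_seq [seq gadget_code a | a <- acc]) =
    code_seq [seq gadget_code a | a <- catrev l acc].
  rewrite /code_pairs; elim: l acc => //= a l ih acc sub.
  have [e _] := edges_len (sub a (mem_head _ _)).
  rewrite -ih => [|b bl]; last by apply: sub; rewrite inE bl orbT.
  by rewrite /forth_step /= /gadget_code e.
rewrite reach_envE [in_arcs _]/= -[Leaf in tfold (kept_step _ _) _ Leaf]/(code_seq [seq gadget_code a | a <- [::]]).
by rewrite kept back // forth // /gadget_arcs.
Qed.

Lemma mem_edges_at x j : ((new j, old x) \in edges) = attached j x.
Proof.
rewrite mem_cat; apply/orP/idP => [[/flattenP[_ /mapP[y _ ->] /mapP[i]]|/mapP[i _]]|h].
- rewrite mem_filter => /andP[h _] e.
  have [/= /new_inj -> /old_inj ->] := (congr1 fst e, congr1 snd e).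
  exact: h.
- by move/(congr1 snd)/eqP; rewrite old_new.
left; apply/flattenP; exists (edges_at x); first by apply: map_f; rewrite mem_enum.
by apply/mapP; exists j; rewrite // mem_filter h mem_enum.
Qed.

Lemma mem_spokes j j' : ((new j, new j') \in edges) = spoke c j j'.
Proof.
rewrite mem_cat; apply/orP/idP => [[/flattenP[_ /mapP[y _ ->] /mapP[i _]]|/mapP[i]]|].
- by move/(congr1 snd)/eqP; rewrite new_old.
- rewrite mem_filter => /andP[h _] e.
  have [/= /new_inj -> /new_inj ->] := (congr1 fst e, congr1 snd e).
  by rewrite /spoke eqxx h.
case/andP=> /eqP j0 h; right; apply/mapP; exists j'; first by rewrite mem_filter h mem_enum.
by congr (new _, _); apply: val_inj.
Qed.

Lemma mem_edges_old x v : ((old x, v) \in edges) = false.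
Proof.
apply/negP; rewrite mem_cat => /orP[/flattenP[_ /mapP[y _ ->] /mapP[j _]]|/mapP[j _]];
  by move/(congr1 fst)/eqP; rewrite old_new.
Qed.

Lemma uniq_edges : uniq edges.
Proof.
rewrite /edges cat_uniq; apply/and3P; split.
- apply: allpairs_uniq_dep => [|x _|]; first exact: enum_uniq.
    by rewrite filter_uniq ?enum_uniq.
  move=> [x j] [x' j'] _ _ /= e.
  by have [/= /new_inj -> /old_inj ->] := (congr1 fst e, congr1 snd e).
- apply/hasPn=> _ /mapP[j _ ->]; apply/negP=> /flattenP[_ /mapP[y _ ->] /mapP[i _]].
  by move/(congr1 snd)/eqP; rewrite new_old.
- rewrite map_inj_uniq => [|i j e]; first exact: filter_uniq (enum_uniq _).
  exact: (new_inj (congr1 snd e)).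
Qed.

Lemma gadget_arcs_lists : lists gadget_arcs (@arcs H).
Proof.
have [us _] := ls; split.
  rewrite /gadget_arcs !catrevE cat_uniq rev_uniq uniq_edges cat_uniq !rev_uniq.
  rewrite map_inj_uniq ?uniq_edges; last by move=> [x y] [x' y'] [-> ->].
  rewrite map_inj_uniq ?filter_uniq //; last first.
    move=> [x y] [x' y'] e.
    by have [/= /old_inj -> /old_inj ->] := (congr1 fst e, congr1 snd e).
  rewrite andbT /=; apply/andP; split; last first.
    apply/hasPn=> a; rewrite !mem_rev => /mapP[b _ ->]; apply/negP=> /mapP[[x y] xy].
    case=> e1 e2; move: xy; rewrite -e2; by rewrite mem_edges_old.
  apply/hasPn=> a; rewrite mem_cat !mem_rev => /orP[]; last first.
    by move=> /mapP[b _ ->]; rewrite mem_edges_old.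
  move=> /mapP[[u v] /= + ->]; case: (vertexP u) => x; first by rewrite mem_edges_old.
  case: (vertexP v) => y; first by rewrite mem_edges_old.
  by rewrite !mem_spokes /spoke; lia.
move=> [u v]; rewrite /gadget_arcs !catrevE !mem_cat !mem_rev.
have -> : ((u, v) \in [seq (a.2, a.1) | a <- edges]) = ((v, u) \in edges).
  by apply/mapP/idP => [[[x y] xy [-> ->]]|h] //; exists (v, u).
have kept_fst j w : ((new j, w) \in [seq (old a.1, old a.2) | a <- s & reached a.1]) = false.
  by apply/mapP=> -[a _ /(congr1 fst)/eqP]; rewrite new_old.
have kept_snd j w : ((w, new j) \in [seq (old a.1, old a.2) | a <- s & reached a.1]) = false.
  by apply/mapP=> -[a _ /(congr1 snd)/eqP]; rewrite new_old.
have -> : ((u, v) \in @arcs H) = gadget_arc s1 s2 t1 t2 c u v by [].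
case: (vertexP u) => x; case: (vertexP v) => y;
  rewrite ?gadget_arcE ?mem_edges_old ?mem_edges_at ?mem_spokes ?orFb.
- apply/mapP/andP => [[[x' y']] | [xy Rx]].
    rewrite mem_filter sE => /andP[/= Rx xy] e.
    by have [/= /old_inj -> /old_inj ->] := (congr1 fst e, congr1 snd e).
  by exists (x, y); rewrite // mem_filter sE /= Rx.
- by rewrite kept_snd orbF.
- by rewrite kept_fst orbF.
- by rewrite kept_fst orbF.
Qed.

(** Codes of instances are the same for both values of the direction flag, so this covers undirected
    graphs as well. *)
Lemma transformation_correct :
  @codes_inst (ml_cap_steiner_tree true) (out_inst K c env) H.
Proof.
exists gadget_arcs, [seq new j | j : 'I_K.+1 <- enum 'I_K.+1 & 0 < j]; split.
- exact: gadget_arcs_lists.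
- split=> [|v].
    by rewrite map_inj_uniq; [exact: filter_uniq (enum_uniq _) | exact: new_inj].
  case: (vertexP v) => [x|j].
    by rewrite [RHS]old_terminal; apply/mapP => -[j _ /eqP]; rewrite old_new.
  rewrite mem_map; last exact: new_inj.
  by rewrite mem_filter mem_enum andbT [RHS]new_terminal lt0n.
rewrite /out_inst; congr (Node _ (Node _ (Node _ _))).
- exact: iter_code_unary.
- exact: out_arcsE.
- rewrite /out_terminals -val_enum_ord filter_map -!map_comp; congr code_seq.
  by apply: eq_map => j; rewrite /= tnewE.
- exact: (congr2 Node (tnewE ord0) erefl).
Qed.

End TransformationCorrect.

(** * Correctness of the tracing program *)

Section TraceCorrect.

Variables (n : nat) (s : seq ('I_n * 'I_n)).
Hypothesis functional_s : forall u u' v, (u, v) \in s -> (u', v) \in s -> u = u'.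

Local Notation scode := (code_seq [seq code_pair a | a <- s]).

Lemma tparentE u v : (u, v) \in s -> tparent (code_vertex v) scode = code_vertex u.
Proof.
move=> uv; rewrite /tparent.
have fold l c : {subset l <= s} ->
    tfold (parent_step (code_vertex v)) (code_seq [seq code_pair a | a <- l]) c =
    if has (fun a => a.2 == v) l then code_vertex u else c.
  elim: l c => // -[x y] l ih c sub; rewrite [LHS]/= ih; last first.
    by move=> b bl; apply: sub; rewrite inE bl orbT.
  rewrite /parent_step truth_tbool /= (inj_eq (@code_vertex_inj n)) eq_sym.
  case: eqP => [ey|_] //=; rewrite (_ : x = u) ?if_same //.
  by apply: functional_s (v) _ uv; rewrite -ey sub // mem_head.
rewrite fold //; case: hasP => // -[]; by exists (u, v) => /=.
Qed.

Lemma traceE a b mu : links (fun u v => (u, v) \in s) a b mu ->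
  trace scode (code_vertex a) (code_vertex b) = code_vertices mu.
Proof.
move=> lmu; have smu : size mu <= (size s).+1.
  have uz : uniq (zip mu (behead mu)).
    apply: (@map_uniq _ _ snd); rewrite -/(unzip2 _) unzip2_zip_behead.
    by case: mu lmu => // z q /and4P[_ _ _ /andP[]].
  have h : size (zip mu (behead mu)) <= size s.
    by apply: uniq_leq_size uz _ => -[x y] /(links_zip lmu).
  by move: h; rewrite size_zip size_behead; case: (size mu) => //= k; lia.
case: mu lmu smu => // z q /and4P[/eqP -> aq /eqP <- uq] sq.
(* With the path known from index [i] on, [i] parents are missing, and any counter of length at
   least [i] will do. *)
have fold (l : seq tree) i : i <= size q -> i <= size l ->
    tfold (trace_step (Node scode (code_vertex a))) (code_seq l)
      (code_vertices (drop i (a :: q))) = code_vertices (a :: q).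
  elim: l i => [|t l ih] i iq; first by rewrite leqn0 => /eqP ->.
  move=> il; rewrite [LHS]/= (drop_nth a) //.
  rewrite /trace_step truth_tbool /= (inj_eq (@code_vertex_inj n)).
  case: i il iq => [|i] il iq; first by rewrite /= eqxx drop0; apply: (ih 0).
  (* The path is simple, so the walk does not stop too early. *)
  have -> : (nth a (a :: q) i.+1 == a) = false.
    apply/negbTE; rewrite -[a in _ == a]/(nth a (a :: q) 0).
    by rewrite nth_uniq.
  rewrite (@tparentE (nth a (a :: q) i)); last exact: (pathP a aq).
  rewrite -[RHS](ih i) // ?(ltnW iq) //; congr tfold.
  by rewrite (drop_nth a (n := i)) 1?(drop_nth a (n := i.+1)) // ltnW.
rewrite /trace -[RHS](fold [seq code_pair a | a <- s] (size q)) //; last first.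
  by rewrite size_map; move: sq.
by rewrite (drop_nth a) //= drop_oversize // (last_nth a).
Qed.

End TraceCorrect.

(** * The reduction *)

Section Reduction.

Variables (K c : nat) (directed : bool).
Hypotheses (c2 : 2 <= c) (cK : c.+2 <= K).

Local Notation P := (ml_vdisj_path directed 2).
Local Notation Q := (ml_cap_steiner_tree directed).

Section Instance.

Variable I : vdp_inst 2.

Local Notation s1 := (tnth (ends I) ord0).1.
Local Notation t1 := (tnth (ends I) ord0).2.
Local Notation s2 := (tnth (ends I) ord_max).1.
Local Notation t2 := (tnth (ends I) ord_max).2.

Definition vdp_gadget : cst_inst := gadget s1 s2 t1 t2 K c.

Lemma endsE : ends I = [:: (s1, t1); (s2, t2)] :> seq _.
Proof. by case: (ends I) => [[|[x y] [|[x' y'] []]]]. Qed.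

Lemma forall_ord2 (R : 'I_2 -> Prop) : R ord0 -> R ord_max -> forall i, R i.
Proof.
move=> h0 h1 [[|[|//]] h]; first by rewrite (_ : Ordinal h = ord0) //; apply: val_inj.
by rewrite (_ : Ordinal h = ord_max) //; apply: val_inj.
Qed.

Lemma tuple2_tnth (T : Type) (mu : 2.-tuple T) :
  mu = [tuple tnth mu ord0; tnth mu ord_max].
Proof. by apply: eq_from_tnth; apply: forall_ord2. Qed.

Lemma vdp_feasible mu1 mu2 :
  @feasible P I [tuple mu1; mu2] <->
  [/\ links (@arc I) s1 t1 mu1, links (@arc I) s2 t2 mu2 & [disjoint mu1 & mu2]].
Proof.
split=> [[l d]|[l1 l2 d]].
  by split; [exact: (l ord0) | exact: (l ord_max) | exact: (d ord0 ord_max)].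
split; first by apply: forall_ord2.
by apply: forall_ord2; apply: forall_ord2 => //= _; rewrite disjoint_sym.
Qed.

Lemma vdp_value mu1 mu2 :
  @value P I [tuple mu1; mu2] = (path_length mu1 + path_length mu2)%R.
Proof.
rewrite /value /= big_ord_recl big_ord1; congr (_ + path_length _)%R.
Qed.

Lemma vdp_tree mu1 mu2 : @feasible P I [tuple mu1; mu2] ->
  exists2 S, @feasible Q vdp_gadget S &
    @value Q vdp_gadget S = @value P I [tuple mu1; mu2].
Proof.
case/vdp_feasible; case: mu1 => // x1 q1 l1; case: mu2 => // x2 q2 l2 d.
have /and4P[/eqP e1 _ _ _] := l1; have /and4P[/eqP e2 _ _ _] := l2; subst x1 x2.
exists (tree_of_paths s1 s2 t1 t2 K c q1 q2); first exact: tree_of_paths_feasible.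
by rewrite vdp_value; apply: tree_of_paths_value.
Qed.

Lemma tree_vdp S : @feasible Q vdp_gadget S ->
  exists mu1 mu2,
  [/\ links (tree_arc S) s1 t1 mu1, links (tree_arc S) s2 t2 mu2
    & @feasible P I [tuple mu1; mu2]].
Proof.
move=> fS; have [mu1 l1] := links_tree (connect_s1_t1 c2 cK fS)
  (no_new_s1_t1 c2 cK fS).
have [mu2 l2] := links_tree (connect_s2_t2 c2 cK fS) (no_new_s2_t2 c2 cK fS).
exists mu1, mu2; split=> //; apply/vdp_feasible.
have lsub x y mu : links (tree_arc S) x y mu -> links (@arc I) x y mu.
  case: mu => // z q /and4P[xz zq qy uq]; apply/and4P; split=> //.
  by apply: (sub_path _ zq) => u v; exact: (tree_arc_sub fS).
by split; [exact: lsub | exact: lsub | exact: disjoint_tree_links fS _ _ l1 l2].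
Qed.

(** The tree may be longer than its two paths, but it is no longer than the tree built from any
    feasible [mu'], whose value is exactly the length of [mu']. *)
Lemma optimal_vdp S : is_wgraph directed I -> @optimal Q vdp_gadget S ->
  exists mu1 mu2,
  [/\ links (tree_arc S) s1 t1 mu1, links (tree_arc S) s2 t2 mu2
    & @optimal P I [tuple mu1; mu2]].
Proof.
move=> [_ len0 _] [fS optS]; have [mu1 [mu2 [l1 l2 fmu]]] := tree_vdp fS.
exists mu1, mu2; split=> //; split=> // mu'; rewrite (tuple2_tnth mu') => fmu'.
have [S' fS' <-] := vdp_tree fmu'.
apply: le_trans (optS _ fS'); rewrite vdp_value.
exact: (tree_links_length c2 cK fS len0 l1 l2).
Qed.

Lemma vdp_code d : @codes_inst P d I ->
  exists2 s, lists s (@arcs I) & d = instance_code s1 s2 t1 t2 s.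
Proof. by case=> s ls ->; exists s => //; rewrite endsE. Qed.

Lemma out_pathsE S d e mu1 mu2 :
  @feasible Q vdp_gadget S -> @codes_inst P d I -> @codes_sol Q vdp_gadget e S ->
  links (tree_arc S) s1 t1 mu1 -> links (tree_arc S) s2 t2 mu2 ->
  @codes_sol P I (out_paths (Node d e)) [tuple mu1; mu2].
Proof.
move=> fS /vdp_code[s _ ->] [sS [_ lS] ->] l1 l2.
have fsS u u' v : (u, v) \in sS -> (u', v) \in sS -> u = u'.
  have arbS : arborescence (root vdp_gadget) S by case: fS.
  by rewrite !lS => uv; exact: (arborescence_functional arbS uv).
have tr x y mu : links (tree_arc S) x y mu ->
    trace (code_seq [seq code_pair a | a <- sS]) (code_vertex x) (code_vertex y) =
    code_seq [seq code_vertex v | v <- mu].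
  (* The embedding [o] preserves unary codes, so a trace in the tree is literally the code of a path
     in the original graph. *)
  move=> lmu; pose o (z : vertex I) : 'I_(order I + K.+1) := lshift K.+1 z.
  rewrite (@traceE _ sS fsS (o x) (o y) (map o mu)) /code_vertices -?map_comp //.
  case: mu lmu => // z q /and4P[/eqP -> zq /eqP <- uq].
  apply/and4P; split=> //; last 2 first.
  - by rewrite last_map.
  - by change (uniq (map o (x :: q))); rewrite map_inj_uniq //; apply: lshift_inj.
  by rewrite path_map; apply: (sub_path _ zq) => u v; rewrite /= lS.
by rewrite /out_paths /= /in_s1 /in_s2 /in_t1 /in_t2 /= (tr _ _ _ l1) (tr _ _ _ l2).
Qed.

End Instance.

End Reduction.

Theorem theorem4p3 (K c : nat) (hK : 4 <= K) (hc : 2 <= c) (hcK : c <= K - 2)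
    (directed : bool) :
  poly_reducible (ml_vdisj_path directed 2)
    (@restrict (ml_cap_steiner_tree directed) (uniform_instance K c)).
Proof.
have cK : c.+2 <= K by lia.
have [F [bF [[aF [kF hF]] rF]]] := polyfun_transformation K c.
have [G [bG [[aG [kG hG]] rG]]] := polyfun_out_paths.
exists (vdp_gadget K c), F, G, (aF + aG), (kF + kG).
have leF n : 0 < n -> bF n <= (aF + aG) * n ^ (kF + kG).
  by move=> n0; apply: leq_trans (hF n n0) _; rewrite leq_mul ?leq_addr ?leq_pexp2l ?leq_addr.
have leG n : 0 < n -> bG n <= (aF + aG) * n ^ (kF + kG).
  by move=> n0; apply: leq_trans (hG n n0) _; rewrite leq_mul ?leq_addl ?leq_pexp2l ?leq_addl.
move=> I [wI _]; split.
- split; first exact: gadget_is_cst_inst.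
  by split; first exact: card_terminals.
- move=> d /vdp_code[s ls ->]; exists (out_inst K c (reach_env (instance_code
    (tnth (ends I) ord0).1 (tnth (ends I) ord_max).1
    (tnth (ends I) ord0).2 (tnth (ends I) ord_max).2 s))).
    exact: transformation_correct.
  by apply: runs_within_le (rF _) _; apply: leF; apply: tsize_gt0.
- split=> [[mu]|[S fS]].
    by rewrite (tuple2_tnth mu) => /(vdp_tree hc cK)[S fS _]; exists S.
  by have [mu1 [mu2 [_ _ fmu]]] := tree_vdp hc cK fS; exists [tuple mu1; mu2].
- move=> d S e cd optS cS; have [fS _] := optS.
  have [mu1 [mu2 [l1 l2 omu]]] := optimal_vdp hc cK wI optS.
  exists [tuple mu1; mu2], (out_paths (Node d e)); split=> //.
    exact: out_pathsE fS cd cS l1 l2.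
  by apply: runs_within_le (rG _) _; apply: leG; apply: tsize_gt0.
Qed.
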